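(* Let $G$ be a 2.5-connected graph with set of triconnected components $\mathcal{I}$. Then $G$ is critical 2.5-connected if and only if the following two conditions hold: (a) every $k$-edge $M\in\mathcal{I}$ containing a non-virtual edge is a 3-edge which contains exactly one virtual edge, and the unique neighbour of $M$ in $S(\mathcal{I})$ is a cycle; (b) every other component $H\in\mathcal{I}$ has the property that each non-virtual edge of $H$ lies in a vertex-2-edge-separator $(c,e_1,e_2)$ of $H$ with both $e_1$ and $e_2$ non-virtual.
   Context: Graphs are finite, may have parallel edges, no loops; a graph of order 2 with $k\ge2$ edges is a $k$-edge. Biconnected: connected and for all pairwise distinct $u,v,w$ there is a $u$-$v$ path avoiding $w$. A biconnected graph (not a triangle) is 2.5-connected if there is no $(c,e)\in V\times E$ with the graph minus $e$ and $c$ disconnected. For a biconnected graph $H$, a vertex-2-edge-separator is a triple $(c,e_1,e_2)\in V(H)\times E(H)^2$ with $H-e_1-e_2-c$ disconnected. $G$ is critical 2.5-connected if it is 2.5-connected and for every $e\in E(G)$, $G-e$ is not 2.5-connected. Splits: for biconnected $H$ and $u,v\in V(H)$, edges are in the same separation class iff they lie on a common (possibly closed) path with neither $u$ nor $v$ internal; $\{u,v\}$ is a separation pair if some union $E'$ of some but not all classes has $\min\{|E'|,|E(H)\setminus E'|\}\ge2$; a split replaces $H$ by $H[E']+e_1$ and $H[E(H)\setminus E']+e_2$ with new edges $e_1,e_2$ joining $u,v$, which are virtual and correspond to each other; edges of $G$ are non-virtual. Triconnected: biconnected without separation pair. Splitting until impossible and then merging (gluing at corresponding virtual edges and deleting them)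 triangles as much as possible into cycles and 3-edges as much as possible into multiedges gives the triconnected components. $S(\mathcal{I})$ is the graph with vertex set $\mathcal{I}$, two members adjacent iff they contain corresponding virtual edges.
   Formalization: The graph G is assumed not to have exactly one edge, i.e. G is not K2: K2 is critical 2.5-connected by the definitions, but its edge lies in no vertex-2-edge-separator and K2 is not a k-edge, so the equivalence fails there. *)

(* Defs.v *)
From HB Require Import structures.
From mathcomp Require Import all_boot.
From mathcomp Require Import finmap.
From Stdlib Require Import Relations.

Set Implicit Arguments.
Unset Strict Implicit.
Unset Printing Implicit Defensive.

Local Open Scope fset_scope.

Section Graphs.
Variables (T E : choiceType).

(* Edge labels: [inl e] = an edge e of the original graph G (non-virtual),
   [inr (k,b)] = a virtual edge; [inr (k,true)] and [inr (k,false)]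
   correspond to each other. *)
Definition lab := (E + (nat * bool))%type.

Variable ends : lab -> T * T.

Definition graph := ({fset T} * {fset lab})%type.
Definition gV (g : graph) : {fset T} := g.1.
Definition gE (g : graph) : {fset lab} := g.2.

Definition joins (e : lab) (u v : T) : bool :=
  (ends e == (u, v)) || (ends e == (v, u)).
Definition incident (e : lab) (x : T) : bool :=
  ((ends e).1 == x) || ((ends e).2 == x).

Definition wf_graph (g : graph) : Prop :=
  forall e, e \in gE g ->
    [/\ (ends e).1 \in gV g, (ends e).2 \in gV g & (ends e).1 != (ends e).2].

Definition adj (g : graph) (u v : T) : Prop :=
  [/\ u \in gV g, v \in gV g & exists e, e \in gE g /\ joins e u v].

Inductive reach (g : graph) : T -> T -> Prop :=
| reach0 u : u \in gV g -> reach g u u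
| reachS u w v : reach g u w -> adj g w v -> reach g u v.

Definition connected (g : graph) : Prop :=
  forall u v, u \in gV g -> v \in gV g -> reach g u v.

Definition delv (g : graph) (c : T) : graph :=
  (gV g `\ c, [fset e in gE g | ~~ incident e c]).
Definition dele (g : graph) (e : lab) : graph := (gV g, gE g `\ e).

Definition biconnected (g : graph) : Prop :=
  connected g /\
  forall u v w, u \in gV g -> v \in gV g -> w \in gV g ->
    u != v -> u != w -> v != w -> reach (delv g w) u v.

(* Paths: start vertex x0 and steps (e_i, x_i); vertices pairwise distinct
   except that possibly x0 = x_n (closed path); edges pairwise distinct. *)
Fixpoint walk (g : graph) (x : T) (s : seq (lab * T)) : Prop :=
  match s with
  | [::] => True
  | (e, y) :: s' => [/\ e \in gE g, joins e x y & walk g y s']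
  end.

Definition is_path (g : graph) (x0 : T) (s : seq (lab * T)) : Prop :=
  [/\ s != [::], walk g x0 s, uniq (map fst s), uniq (map snd s)
    & uniq (belast x0 (map snd s))].

Definition internal (x0 : T) (s : seq (lab * T)) : seq T :=
  behead (belast x0 (map snd s)).

Definition is_cycle (g : graph) : Prop :=
  exists x0 s, [/\ is_path g x0 s, last x0 (map snd s) = x0, 3 <= size s,
    (forall e, e \in gE g <-> e \in map fst s)
    & (forall x, x \in gV g <-> x \in map snd s)].

Definition is_triangle (g : graph) : Prop := is_cycle g /\ #|` gE g| = 3.

Definition kedge (k : nat) (g : graph) : Prop :=
  [/\ #|` gV g| = 2, #|` gE g| = k & 2 <= k].

Definition twofive (g : graph) : Prop :=
  biconnected g /\
  (is_triangle g \/
   ~ exists c e, [/\ c \in gV g, e \in gE g & ~ connected (delv (dele g e) c)]).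

Definition critical (g : graph) : Prop :=
  twofive g /\ forall e, e \in gE g -> ~ twofive (dele g e).

Definition v2e_sep (g : graph) (c : T) (e1 e2 : lab) : Prop :=
  [/\ c \in gV g, e1 \in gE g, e2 \in gE g
    & ~ connected (delv (dele (dele g e1) e2) c)].

Definition same_class (g : graph) (u v : T) (e f : lab) : Prop :=
  exists x0 s, [/\ is_path g x0 s, u \notin internal x0 s,
    v \notin internal x0 s, e \in map fst s & f \in map fst s].

Definition sep_witness (g : graph) (u v : T) (E' : {fset lab}) : Prop :=
  [/\ u \in gV g, v \in gV g, u != v, E' `<=` gE g
    & (forall e f, e \in gE g -> f \in gE g -> same_class g u v e f ->
       e \in E' -> f \in E')] /\
  2 <= #|` E'| /\ 2 <= #|` (gE g `\` E')|.

Definition sep_pair (g : graph) (u v : T) : Prop :=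
  exists E', sep_witness g u v E'.

Definition virt (k : nat) (b : bool) : lab := inr (k, b).
Definition virtual (e : lab) : Prop := exists k b, e = virt k b.
Definition nonvirtual (e : lab) : Prop := exists x, e = inl x.
Definition corr (e f : lab) : Prop := exists k b, e = virt k b /\ f = virt k (~~ b).

Definition part (g : graph) (E' : {fset lab}) (u v : T) (e : lab) : graph :=
  ([fset (ends x).1 | x in E'] `|` [fset (ends x).2 | x in E'] `|` [fset u; v],
   [fset e] `|` E').

Definition fresh (k : nat) (S : seq graph) : Prop :=
  forall H, H \in S -> forall b, virt k b \notin gE H.

Definition split_step (S S' : seq graph) : Prop :=
  exists S1 S2 H u v E' k,
    [/\ S = S1 ++ H :: S2, sep_witness H u v E', fresh k S,
      joins (virt k true) u v & joins (virt k false) u v] /\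
    S' = S1 ++ part H E' u v (virt k true)
              :: part H (gE H `\` E') u v (virt k false) :: S2.

Definition merge (H1 H2 : graph) (e1 e2 : lab) : graph :=
  (gV H1 `|` gV H2, (gE H1 `\ e1) `|` (gE H2 `\ e2)).

Definition mergeable (H1 H2 : graph) : Prop :=
  (is_cycle H1 /\ is_cycle H2) \/ (exists k1 k2, kedge k1 H1 /\ kedge k2 H2).

Definition merge_step (S S' : seq graph) : Prop :=
  exists S1 S2 S3 H1 H2 e1 e2,
    [/\ S = S1 ++ H1 :: S2 ++ H2 :: S3, e1 \in gE H1, e2 \in gE H2,
      corr e1 e2 & mergeable H1 H2] /\
    S' = S1 ++ merge H1 H2 e1 e2 :: S2 ++ S3.

Definition tricomps (G : graph) (I : seq graph) : Prop :=
  exists S, [/\ clos_refl_trans _ split_step [:: G] S,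
    (forall H, H \in S -> forall u v, ~ sep_pair H u v),
    clos_refl_trans _ merge_step S I
    & ~ exists I', merge_step I I'].

Definition comp (I : seq graph) (i : nat) : graph := nth (fset0, fset0) I i.

Definition sadj (I : seq graph) (i j : nat) : Prop :=
  i != j /\ exists e1 e2, [/\ e1 \in gE (comp I i), e2 \in gE (comp I j)
                            & corr e1 e2].

Definition kedge_nonvirt (M : graph) : Prop :=
  (exists k, kedge k M) /\ (exists e, e \in gE M /\ nonvirtual e).

Definition condA (I : seq graph) : Prop :=
  forall i, i < size I -> kedge_nonvirt (comp I i) ->
    [/\ kedge 3 (comp I i),
      (exists e, [/\ e \in gE (comp I i), virtual e &
         forall e', e' \in gE (comp I i) -> virtual e' -> e' = e])
    & (exists j, [/\ j < size I, sadj I i j,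
         (forall j', j' < size I -> sadj I i j' -> j' = j)
       & is_cycle (comp I j)])].

Definition condB (I : seq graph) : Prop :=
  forall i, i < size I -> ~ kedge_nonvirt (comp I i) ->
    forall e, e \in gE (comp I i) -> nonvirtual e ->
      exists c e1 e2, [/\ v2e_sep (comp I i) c e1 e2, e = e1 \/ e = e2,
                         nonvirtual e1 & nonvirtual e2].

End Graphs.

Definition Gof (T E : choiceType) (VG : {fset T}) (EG : {fset E}) : graph T E :=
  (VG, [fset (inl e : lab E) | e in EG]).

(* Main.v *)
Require Import Defs.
From HB Require Import structures.
From mathcomp Require Import all_boot.
From mathcomp Require Import finmap zify.
From Stdlib Require Import Relations Classical ClassicalEpsilon.
Local Open Scope fset_scope.

Set Implicit Arguments.
Unset Strict Implicit.
Unset Printing Implicit Defensive.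

(* Call (c, e, f) a separator if deleting the vertex c and the edges e and f
   disconnects the graph. A 2.5-connected graph G is critical iff each of its
   edges lies in a separator of G. Every edge x of a component H stands for a
   set R x of edges of G: non-virtual edges stand for themselves, corresponding
   virtual edges stand for complementary sets, the sets R x with x in H
   partition E(G), and R x meets the rest of G only in the ends of x. Hence for
   c in V(H) a set of edges of H separates H - c iff the set it stands for
   separates G - c.

   Let (c, e, f) be a separator of G and H the component that contains e. If f
   were represented in H by a virtual edge x, then 2.5-connectivity would fail
   at the 2-separation R x; so f is an edge of H. If c is a vertex of H, then
   (c, e, f) separates H. Otherwise c is strictly inside some R y, and an end of
   y can replace c, unless e and f are the only edges outside R y. In that case
   H is the 3-edge {y, e, f}, and c shows that the virtual edge corresponding to
   y becomes a bridge when a vertex of its component H' is deleted, which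
   forces H' to be a cycle. *)

(** Why a separator cannot straddle a 2-separation: the vertex [c] is strictly inside at most one of
    the two sides. A case analysis then shows that one of [e] and [f], together with [c] or with an
    end of the separation, already disconnects G. This needs a second edge on each side. Every split
    provides two edges for each new [R x], and every component with a virtual edge has at least
    three edges.

    The map [R] is built along the splitting: the two labels of a split receive complementary
    unions, and all later splits and merges leave these values alone. So every component is compared
    with G directly, without an induction along the tree of components.

    The triangle is exempt from the condition on pairs [(c, e)] and has to be treated apart. With
    fewer than four edges no split is possible, so it is its own only component. *)

Definition asb (P : Prop) : bool :=
  if excluded_middle_informative P then true else false.

Lemma asbP (P : Prop) : reflect P (asb P).
Proof. by rewrite /asb; case: excluded_middle_informative => ?; constructor. Qed.

(** * Vertex cuts, described by one side instead of by missing paths *)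

Section Cuts.
Variables (T E : choiceType) (ends : lab E -> T * T).
Implicit Types (e f g x : lab E) (a b c p q u v w z : T).
Implicit Types (V : {fset T}) (A F : pred (lab E)).

Lemma joinsC e p q : joins ends e p q = joins ends e q p.
Proof. by rewrite /joins orbC. Qed.

Lemma joins_incidentl e p q : joins ends e p q -> incident ends e p.
Proof. by rewrite /joins /incident => /orP[]/eqP-> /=; rewrite eqxx ?orbT. Qed.

Lemma joins_incidentr e p q : joins ends e p q -> incident ends e q.
Proof. by rewrite joinsC; apply: joins_incidentl. Qed.

Lemma joins_incident e p q w :
  joins ends e p q -> incident ends e w -> w = p \/ w = q.
Proof.
by rewrite /joins /incident => /orP[]/eqP-> /= /orP[]/eqP->; auto.
Qed.

Lemma incident_joins e p : incident ends e p -> exists q, joins ends e p q.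
Proof.
rewrite /incident /joins; case: (ends e) => s t /= /orP[]/eqP->.
  by exists t; rewrite eqxx.
by exists s; rewrite eqxx orbT.
Qed.

Lemma joins_ends e : joins ends e (ends e).1 (ends e).2.
Proof. by rewrite /joins -surjective_pairing eqxx. Qed.

Lemma wf_joins (H : graph T E) e p q : wf_graph ends H -> e \in gE H ->
  joins ends e p q -> [/\ p \in gV H, q \in gV H & p != q].
Proof.
move=> wfH eH; rewrite /joins => /orP[]/eqP ee; have := wfH e eH;
  by rewrite ee /= => -[? ? ?]; split; rewrite // eq_sym.
Qed.

(* Deleting [c] disconnects the graph with vertices [V] and edges [A]; [X] is
   one side. *)
Definition cut V A c : Prop :=
  exists (X : pred T) a b,
    [/\ [/\ a \in V, b \in V, a != c & b != c], X a, ~~ X b &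
      forall e p q, A e -> joins ends e p q -> p != c -> q != c -> X p -> X q].

Lemma sub_cut V A (B : pred (lab E)) c :
  (forall e, B e -> A e) -> cut V A c -> cut V B c.
Proof.
move=> sBA [X [a [b [Vab Xa Xb cl]]]]; exists X, a, b; split=> // e p q /sBA.
exact: cl.
Qed.

(** An edge joins its ends in both orders, so closure of a side along edges is already equality of
    the two values. *)
Lemma cut_sym V A c : cut V A c ->
  exists (X : pred T) a b,
    [/\ [/\ a \in V, b \in V, a != c & b != c], X a, ~~ X b &
      forall e p q, A e -> joins ends e p q -> p != c -> q != c -> X p = X q].
Proof.
case=> X [a [b [Vab Xa Xb cl]]]; exists X, a, b; split=> // e p q Ae epq pc qc.
apply/idP/idP; first exact: cl epq pc qc.
by apply: (cl e q p) => //; rewrite joinsC.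
Qed.

(** The complement of a side is a side, so a chosen vertex may be assumed to lie in it. *)
Lemma cut_at V A c u : u \in V -> u != c -> cut V A c ->
  exists (X : pred T) b, [/\ b \in V, b != c, X u, ~~ X b &
    forall e p q, A e -> joins ends e p q -> p != c -> q != c -> X p = X q].
Proof.
move=> uV uc /cut_sym[X [a [b [[aV bV ac bc] Xa Xb cl]]]].
case Xu: (X u); first by exists X, b; split.
exists (predC X), a; split=> //=; rewrite ?Xu ?Xa // => e p q Ae epq pc qc.
by rewrite (cl _ _ _ Ae epq).
Qed.

Lemma reach_closed (g : graph T E) (X : pred T) a b :
  (forall e p q, e \in gE g -> joins ends e p q -> X p -> X q) ->
  reach ends g a b -> X a -> X b.
Proof.
move=> cl; elim=> // u w v _ IH [_ _ [e [eg ej]]] /IH; exact: cl ej.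
Qed.

Lemma reach_delv_closed (g : graph T E) (X : pred T) c a b :
  (forall e p q, e \in gE g -> joins ends e p q -> p != c -> q != c ->
     X p -> X q) ->
  reach ends (delv ends g c) a b -> X a -> X b.
Proof.
move=> cl; apply: reach_closed => e p q; rewrite !inE /= => /andP[eg ec] epq.
apply: (cl _ _ _ eg epq).
  by apply: contraNneq ec => <-; exact: joins_incidentl epq.
by apply: contraNneq ec => <-; exact: joins_incidentr epq.
Qed.

Lemma not_reach_cut (g : graph T E) c a b : wf_graph ends g ->
  a \in gV g -> b \in gV g -> a != c -> b != c ->
  ~ reach ends (delv ends g c) a b -> cut (gV g) (mem (gE g)) c.
Proof.
move=> wfg ag bg ac bc nab.
(* The side is the set reachable from [a]; excluded middle makes it a boolean predicate. *)
exists (fun z => asb (reach ends (delv ends g c) a z)), a, b; split=> //.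
- by apply/asbP/reach0; rewrite !inE /= ac.
- by apply/asbP.
move=> e p q /= eg epq pc qc /asbP rp; apply/asbP; apply: (reachS rp).
have [pg qg _] := wf_joins wfg eg epq.
split; rewrite ?inE /= ?pc ?qc //; exists e; split=> //.
rewrite !inE /= eg /=; apply/negP => /(joins_incident epq)[] eq_c.
  by rewrite eq_c eqxx in pc.
by rewrite eq_c eqxx in qc.
Qed.

Lemma not_connected_cut (g : graph T E) c : wf_graph ends g ->
  ~ connected ends (delv ends g c) <-> cut (gV g) (mem (gE g)) c.
Proof.
move=> wfg; split=> [ncon | [X [a [b [[aV bV ac bc] Xa Xb cl]]]] con]; last first.
  have := con a b; rewrite !inE /= ac bc aV bV => /(_ isT isT).
  by move=> /(reach_delv_closed (X := X))/(_ Xa); rewrite (negPf Xb) => h; apply: notF; apply: h.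
have [a na] := not_all_ex_not _ _ ncon; have [b nb] := not_all_ex_not _ _ na.
have [aV {na}nb] := imply_to_and _ _ nb; have [bV nab] := imply_to_and _ _ nb.
move: aV bV; rewrite !inE /= => /andP[ac aV] /andP[bc bV].
exact: not_reach_cut nab.
Qed.

Lemma biconnected_no_cut (g : graph T E) c :
  biconnected ends g -> c \in gV g -> ~ cut (gV g) (mem (gE g)) c.
Proof.
move=> [_ bic] cg [X [a [b [[aV bV ac bc] Xa Xb cl]]]].
have ab: a != b by apply: contraNneq Xb => <-.
have /(reach_delv_closed (X := X)) := bic a b c aV bV cg ab ac bc.
by rewrite Xa (negPf Xb) => h; apply: notF; apply: h.
Qed.

End Cuts.

(** * Two-separations of the host graph, and separators that meet them *)

Section Separations.
Variables (T E : choiceType) (ends : lab E -> T * T).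
Variables (VG : {fset T}) (EG : {fset lab E}).
Hypothesis wfG : wf_graph ends (VG, EG).
Hypothesis bicG : forall c, c \in VG -> ~ cut ends VG (mem EG) c.
Implicit Types (e f g x : lab E) (a b c p q u v w z : T) (F : pred (lab E)).

Definition touches F w : bool := has (fun g => F g && incident ends g w) EG.

Lemma touchesP F w :
  reflect (exists g, [/\ g \in EG, F g & incident ends g w]) (touches F w).
Proof.
apply: (iffP hasP) => [[g gE /andP[Fg gw]] | [g [gE Fg gw]]]; first by exists g.
by exists g; rewrite // Fg.
Qed.

Lemma eq_touches F (F' : pred (lab E)) w :
  {in EG, F =1 F'} -> touches F w = touches F' w.
Proof. by move=> eqF; apply: eq_in_has => g gE; rewrite eqF. Qed.

Lemma touchesl F g p q : g \in EG -> F g -> joins ends g p q -> touches F p.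
Proof.
by move=> gE Fg gpq; apply/touchesP; exists g; split; rewrite ?(joins_incidentl gpq).
Qed.

Lemma touchesr F g p q : g \in EG -> F g -> joins ends g p q -> touches F q.
Proof. by move=> gE Fg; rewrite joinsC; apply: touchesl. Qed.

Definition inner F w : bool := touches F w && ~~ touches (predC F) w.

(** No lower bound is put on [F] or its complement: a single edge counts, since a non-virtual edge
    stands for itself. Lemmas that need more edges ask for them. *)
Definition sep2 F u v : Prop := [/\ u \in VG, v \in VG, u != v &
  forall w, touches F w -> touches (predC F) w -> w = u \/ w = v].

Definition minus2 e f g : bool := [&& g \in EG, g != e & g != f].
Arguments minus2 e f g /.

Lemma minus2C e f : minus2 e f =1 minus2 f e.
Proof. by move=> g; rewrite /= (andbC (g != e)). Qed.

Lemma sep2_swap F u v : sep2 F u v -> sep2 F v u.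
Proof.
by case=> uV vV uv sF; split; rewrite // 1?eq_sym // => w h /(sF w h)[]; auto.
Qed.

Lemma touches_predCC F w : touches (predC (predC F)) w = touches F w.
Proof. by apply: eq_touches => g _ /=; rewrite negbK. Qed.

Lemma sep2C F u v : sep2 F u v -> sep2 (predC F) u v.
Proof.
by case=> uV vV uv sF; split=> // w h; rewrite touches_predCC => /sF; apply.
Qed.

(** If [F] avoided [u], its only attachment would be [v], and deleting [v] would separate the
    vertices of [F] from [u]. *)
Lemma sep2_touches F u v g : sep2 F u v -> g \in EG -> F g -> touches F u.
Proof.
case=> uV vV uv sF gE Fg; apply/idPn => nu; apply: (bicG vV).
have gj := joins_ends ends g; have [pV qV pq] := wf_joins wfG gE gj.
have [a [aV av Fa]] : exists a, [/\ a \in VG, a != v & touches F a].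
  have [pv|pv] := eqVneq (ends g).1 v; last by exists (ends g).1; rewrite (touchesl gE Fg gj).
  by exists (ends g).2; rewrite -{1}pv eq_sym pq (touchesr gE Fg gj).
exists (touches F), a, u; split=> // h p q /= hE hpq pv' qv' Fp.
have [Fh|nFh] := boolP (F h); first exact: touchesr hpq.
case: (sF p Fp); first by apply: touchesl hpq.
  by move=> pu; rewrite pu (negPf nu) in Fp.
by move=> pu; rewrite pu eqxx in pv'.
Qed.

(** If [u] and [v] are on the same side, the part cut off lies outside [F], and [u] can replace [c].
    If not, a third vertex touched from outside [F] is separated by [u] from [v], or by [v] from
    [u]. If there is no such vertex, all edges outside [F] join [u] to [v] across the cut, so they
    are [e] or [f]. *)
Lemma cut_inner F u v c e f : sep2 F u v -> c \in VG -> inner F c ->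
  u != c -> v != c -> ~~ F e -> ~~ F f ->
  cut ends VG (minus2 e f) c ->
  [\/ cut ends VG (minus2 e f) u, cut ends VG (minus2 e f) v |
      (forall g, g \in EG -> ~~ F g -> (g == e) || (g == f)) /\
      (forall w, touches (predC F) w -> w = u \/ w = v)].
Proof.
move=> [uV vV uv sF] cV /andP[Fc nFc] uc vc Fe Ff /(cut_at uV uc).
case=> X [b [bV bc Xu Xb cl]].
have inF g : g \in EG -> F g -> minus2 e f g.
  by move=> gE Fg /=; rewrite gE /=; apply/andP; split; apply: contraTneq Fg => ->.
have outc g p q : g \in EG -> ~~ F g -> joins ends g p q -> (p != c) && (q != c).
  move=> gE nFg gpq; apply/andP; split; apply: contraNneq nFc => <-.
    exact: touchesl gpq.
  exact: touchesr gpq.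
case Xv: (X v).
  have [Fb|nFb] := boolP (touches F b); last first.
    apply: Or31; exists (fun z => touches F z || X z), v, b; split; rewrite ?Xv ?orbT //.
    - by split; rewrite 1?eq_sym //; apply: contraNneq Xb => <-.
    - by rewrite negb_or nFb.
    move=> g p q gm gpq pu qu; have [gE _] := andP gm.
    have [Fg|nFg] := boolP (F g); first by rewrite (touchesr gE Fg gpq).
    have [pc qc] := andP (outc _ _ _ gE nFg gpq).
    rewrite -(cl _ _ _ gm gpq pc qc) => /orP[Fp|->]; last by rewrite orbT.
    by case: (sF p Fp (touchesl gE nFg gpq)) => ->; rewrite ?Xu ?Xv orbT.
  (* Neither [e] nor [f] is in [F], so a vertex of [F] on the far side would be separated from [u]
     by [c] alone. *)
  case: (bicG cV); exists (fun z => inner F z && ~~ X z), b, u; split=> //.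
  - rewrite Xb andbT /inner Fb /=; apply: contra Xb => nb.
    by case: (sF b Fb nb) => ->.
  - by rewrite Xu andbF.
  move=> g p q gE gpq pc qc /andP[/andP[Fp nFp] Xp].
  have Fg: F g by apply: contraR nFp => nFg; apply: touchesl gpq.
  rewrite /inner (touchesr gE Fg gpq) /= -(cl _ _ _ (inF g gE Fg) gpq pc qc) Xp andbT.
  apply: contra Xp => nFq; rewrite (cl _ _ _ (inF g gE Fg) gpq pc qc).
  by case: (sF q (touchesr gE Fg gpq) nFq) => ->.
have [[w [nFw wu wv]]|no] :=
    classic (exists w, [/\ touches (predC F) w, w <> u & w <> v]); last first.
  have nF w : touches (predC F) w -> w = u \/ w = v.
    move=> h; have [|wu] := classic (w = u); first by left.
    by have [|wv] := classic (w = v); [right | case: no; exists w].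
  apply: Or33; split=> // g gE nFg; apply/idPn; rewrite negb_or => nef.
  have gj := joins_ends ends g; have [_ _ pq] := wf_joins wfG gE gj.
  have [pc qc] := andP (outc _ _ _ gE nFg gj).
  have gm : minus2 e f g by rewrite /= gE.
  have := cl _ _ _ gm gj pc qc.
  case: (nF _ (touchesl gE nFg gj)) (nF _ (touchesr gE nFg gj)) pq => -> [] ->;
    by rewrite ?eqxx ?Xu ?Xv.
have Fw: ~~ touches F w by apply/negP => /sF/(_ nFw)[].
have wV : w \in VG.
  have [g [gE _ /incident_joins[z gj]]] := touchesP _ _ nFw.
  by case: (wf_joins wfG gE gj).
case Xw: (X w).
  apply: Or31; exists (fun z => ~~ touches F z && X z), w, v; split; rewrite ?Fw ?Xw //.
  - by split; rewrite // 1?eq_sym //; apply/eqP => // h; case: wu.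
  - by rewrite Xv andbF.
  move=> g p q gm gpq pu qu /andP[Fp Xp]; have [gE _] := andP gm.
  have nFg: ~~ F g by apply: contra Fp => Fg; apply: touchesl gpq.
  have [pc qc] := andP (outc _ _ _ gE nFg gpq).
  rewrite -(cl _ _ _ gm gpq pc qc) Xp andbT.
  apply/negP => /sF/(_ (touchesr gE nFg gpq))[] eq_q; first by rewrite eq_q eqxx in qu.
  by move: Xp; rewrite (cl _ _ _ gm gpq pc qc) eq_q Xv.
apply: Or32; exists (fun z => ~~ touches F z && ~~ X z), w, u; split; rewrite ?Fw ?Xw //.
- by split=> //; apply/eqP => // h; case: wv.
- by rewrite Xu andbF.
move=> g p q gm gpq pu qu /andP[Fp Xp]; have [gE _] := andP gm.
have nFg: ~~ F g by apply: contra Fp => Fg; apply: touchesl gpq.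
have [pc qc] := andP (outc _ _ _ gE nFg gpq).
rewrite -(cl _ _ _ gm gpq pc qc) Xp andbT.
apply/negP => /sF/(_ (touchesr gE nFg gpq))[] eq_q; last by rewrite eq_q eqxx in qu.
by move: Xp; rewrite (cl _ _ _ gm gpq pc qc) eq_q Xu.
Qed.

Hypothesis twoG : forall c e, c \in VG -> e \in EG ->
  ~ cut ends VG [pred g in EG | g != e] c.

(** Once [u] is gone, the two sides of the separation communicate only through [v]. So the far
    vertex [b] is cut off from [v] by the deleted edge on its own side alone. *)
Lemma no_cut_across_end F u v e f : sep2 F u v -> e \in EG -> f \in EG ->
  ~~ F e -> F f -> ~ cut ends VG (minus2 e f) u.
Proof.
move=> [uV vV uv sF] eE fE Fe Ff; have vu : v != u by rewrite eq_sym.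
case/(cut_at vV vu) => X [b [bV bu Xv Xb cl]].
have [Fb|Fb] := boolP (touches F b).
  apply: (twoG uV fE); exists (fun z => touches (predC F) z || X z), v, b.
  split=> //; first by rewrite Xv orbT.
    rewrite negb_or Xb andbT; apply: contra Xb => nFb.
    by case: (sF b Fb nFb) => eq_b; [rewrite eq_b eqxx in bu | rewrite eq_b].
  move=> g p q /andP[gE gf] gpq pu qu.
  have [Fg|nFg] := boolP (F g); last by rewrite (touchesr (F := predC F) gE nFg gpq).
  have gm : minus2 e f g.
    by rewrite /= [_ \in _]gE [_ != f]gf andbT /=; apply: contraTneq Fg => ->.
  rewrite -(cl _ _ _ gm gpq pu qu) => /orP[Fp|->]; last by rewrite orbT.
  case: (sF p (touchesl gE Fg gpq) Fp) => eq_p; first by rewrite eq_p eqxx in pu.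
  by rewrite eq_p Xv orbT.
apply: (twoG uV eE); exists (fun z => touches F z || X z), v, b.
split=> //; first by rewrite Xv orbT.
  by rewrite negb_or Fb.
move=> g p q /andP[gE ge] gpq pu qu.
have [Fg|nFg] := boolP (F g); first by rewrite (touchesr gE Fg gpq).
have gm : minus2 e f g.
  by rewrite /= [_ \in _]gE [_ != e]ge /=; apply: contraNneq nFg => ->.
rewrite -(cl _ _ _ gm gpq pu qu) => /orP[Fp|->]; last by rewrite orbT.
case: (sF p Fp (touchesl gE nFg gpq)) => eq_p; first by rewrite eq_p eqxx in pu.
by rewrite eq_p Xv orbT.
Qed.

(** If [u] and [v] are on the same side of the cut, [f] with [u] or [e] with [c] suffices. If not,
    the surviving edge [f'] does not join them, so [F] has an inner vertex, and [f] with one of [u],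
    [v] cuts it off. *)
Lemma no_cut_across_outer F u v c e f f' : sep2 F u v -> c \in VG ->
  ~~ touches F c -> u != c -> e \in EG -> f \in EG -> ~~ F e -> F f ->
  f' \in EG -> F f' -> f' != f -> ~ cut ends VG (minus2 e f) c.
Proof.
move=> [uV vV uv sF] cV Fc uc eE fE Fe Ff f'E Ff' f'f /(cut_at uV uc).
case=> X [b [bV bc Xu Xb cl]]; have vu : v != u by rewrite eq_sym.
have inm g : g \in EG -> F g -> g != f -> minus2 e f g.
  by move=> gE Fg gf /=; rewrite gE gf andbT /=; apply: contraTneq Fg => ->.
have inc g p q : g \in EG -> F g -> joins ends g p q -> (p != c) && (q != c).
  move=> gE Fg gpq; apply/andP; split; apply: contraNneq Fc => <-.
    exact: touchesl gpq.
  exact: touchesr gpq.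
case Xv: (X v).
  have [Fb|Fb] := boolP (touches F b).
    apply: (twoG uV fE); exists (fun z => touches (predC F) z || X z), v, b.
    split; first by split=> //; apply: contraNneq Xb => ->.
    - by rewrite Xv orbT.
    - rewrite negb_or Xb andbT; apply: contra Xb => nFb.
      by case: (sF b Fb nFb) => ->.
    move=> g p q /andP[gE gf] gpq pu qu.
    have [Fg|nFg] := boolP (F g); last by rewrite (touchesr (F := predC F) gE nFg gpq).
    have [pc qc] := andP (inc _ _ _ gE Fg gpq).
    rewrite -(cl _ _ _ (inm g gE Fg gf) gpq pc qc) => /orP[Fp|->]; last by rewrite orbT.
    by case: (sF p (touchesl gE Fg gpq) Fp) => ->; rewrite ?Xu ?Xv orbT.
  apply: (twoG cV eE); exists (fun z => touches F z || X z), u, b.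
  split=> //; first by rewrite Xu orbT.
    by rewrite negb_or Fb.
  move=> g p q /andP[gE ge] gpq pc qc.
  have [Fg|nFg] := boolP (F g); first by rewrite (touchesr gE Fg gpq).
  have gm : minus2 e f g.
    by rewrite /= [_ \in _]gE [_ != e]ge /=; apply: contraNneq nFg => ->.
  rewrite -(cl _ _ _ gm gpq pc qc) => /orP[Fp|->]; last by rewrite orbT.
  by case: (sF p Fp (touchesl gE nFg gpq)) => ->; rewrite ?Xu ?Xv orbT.
have [w [Fw wu wv wV]] : exists w, [/\ touches F w, w != u, w != v & w \in VG].
  have gj := joins_ends ends f'; have [pV qV pq] := wf_joins wfG f'E gj.
  have [pc qc] := andP (inc _ _ _ f'E Ff' gj).
  have Xpq := cl _ _ _ (inm f' f'E Ff' f'f) gj pc qc.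
  have [pu|pu] := eqVneq (ends f').1 u; last have [pv|pv] := eqVneq (ends f').1 v.
  - rewrite pu in Xpq pq; exists (ends f').2; rewrite (touchesr f'E Ff' gj) eq_sym pq qV.
    by split=> //; apply/eqP => qv; rewrite qv Xu Xv in Xpq.
  - rewrite pv in Xpq pq; exists (ends f').2; rewrite (touchesr f'E Ff' gj) (eq_sym _ v) pq qV.
    by split=> //; apply/eqP => qu; rewrite qu Xu Xv in Xpq.
  by exists (ends f').1; rewrite (touchesl f'E Ff' gj).
have nFw : ~~ touches (predC F) w.
  by apply/negP => /(sF w Fw)[] eq_w; rewrite eq_w eqxx in wu wv.
(* Without [f], the inner vertices of [F] on the side of [u] are attached to the rest only at [u],
   and those on the other side only at [v]. *)
case Xw: (X w).
  apply: (twoG uV fE); exists (fun z => inner F z && X z), w, v; split=> //.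
  - by rewrite /inner Fw nFw.
  - by rewrite Xv andbF.
  move=> g p q /andP[gE gf] gpq pu qu /andP[/andP[Fp nFp] Xp].
  have Fg: F g by apply: contraR nFp => nFg; apply: touchesl gpq.
  have [pc qc] := andP (inc _ _ _ gE Fg gpq).
  have Xq : X q by rewrite -(cl _ _ _ (inm g gE Fg gf) gpq pc qc).
  rewrite /inner (touchesr gE Fg gpq) Xq andbT /=; apply/negP => nFq.
  case: (sF q (touchesr gE Fg gpq) nFq) => eq_q; first by rewrite eq_q eqxx in qu.
  by rewrite eq_q Xv in Xq.
apply: (twoG vV fE); exists (fun z => inner F z && ~~ X z), w, u; split=> //.
- by rewrite /inner Fw nFw Xw.
- by rewrite Xu andbF.
move=> g p q /andP[gE gf] gpq pu qu /andP[/andP[Fp nFp] Xp].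
have Fg: F g by apply: contraR nFp => nFg; apply: touchesl gpq.
have [pc qc] := andP (inc _ _ _ gE Fg gpq).
have Xq : ~~ X q by rewrite -(cl _ _ _ (inm g gE Fg gf) gpq pc qc).
rewrite /inner (touchesr gE Fg gpq) Xq andbT /=; apply/negP => nFq.
case: (sF q (touchesr gE Fg gpq) nFq) => eq_q; last by rewrite eq_q eqxx in qu.
by rewrite eq_q Xu in Xq.
Qed.

Lemma no_cut_across_half F u v c e f f' : sep2 F u v -> c \in VG ->
  ~~ inner F c -> e \in EG -> f \in EG -> ~~ F e -> F f ->
  f' \in EG -> F f' -> f' != f -> ~ cut ends VG (minus2 e f) c.
Proof.
move=> sF cV; have [uV vV uv sFw] := sF.
rewrite /inner negb_and negbK => iFc eE fE Fe Ff f'E Ff' f'f.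
have [->|uc] := eqVneq c u; first exact: no_cut_across_end sF eE fE Fe Ff.
have [->|vc] := eqVneq c v.
  exact: no_cut_across_end (sep2_swap sF) eE fE Fe Ff.
apply: (@no_cut_across_outer F u v c e f f') => //; last by rewrite eq_sym.
apply/negP => Fc; move: iFc; rewrite Fc /= => /(sFw c Fc)[] eq_c.
  by rewrite eq_c eqxx in uc.
by rewrite eq_c eqxx in vc.
Qed.

(** A vertex inner to [F] is not inner to the complement; in that case the two sides and their edges
    exchange roles. Hence the second edge on both sides. *)
Lemma no_cut_across F u v c e f e' f' : sep2 F u v -> c \in VG ->
  e \in EG -> f \in EG -> ~~ F e -> F f ->
  e' \in EG -> ~~ F e' -> e' != e -> f' \in EG -> F f' -> f' != f ->
  ~ cut ends VG (minus2 e f) c.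
Proof.
move=> sF cV eE fE Fe Ff e'E Fe' e'e f'E Ff' f'f.
have [iFc|iFc] := boolP (inner F c); last exact: no_cut_across_half sF cV iFc eE fE Fe Ff f'E Ff' f'f.
move/(sub_cut (B := minus2 f e)) => h.
apply: (@no_cut_across_half (predC F) u v c f e e' (sep2C sF)) => //=.
- by move: iFc; rewrite /inner touches_predCC => /andP[-> /negPf->].
- by rewrite negbK.
by apply: h => g; rewrite minus2C.
Qed.

End Separations.

(** * Torsos: transfer of cuts between a component and the host graph *)

Section Torsos.
Variables (T E : choiceType) (ends : lab E -> T * T).
Variables (VG : {fset T}) (EG : {fset lab E}).
Hypothesis wfG : wf_graph ends (VG, EG).
Hypothesis bicG : forall c, c \in VG -> ~ cut ends VG (mem EG) c.
Hypothesis degG : forall w, w \in VG -> touches ends EG predT w.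
Implicit Types (e f g x y : lab E) (a b c p q u v w z : T) (H : graph T E).
Implicit Types (R : lab E -> pred (lab E)) (D : pred (lab E)).

Local Notation touches := (touches ends EG).
Local Notation inner := (inner ends EG).
Local Notation sep2 := (sep2 ends VG EG).

(* [R x] is the set of edges of the host graph that the edge [x] of a
   component stands for. *)
Definition stands_for R x : Prop :=
  [/\ forall g, R x g -> g \in EG,
      forall w, incident ends x w -> touches (R x) w
    & forall w, touches (R x) w -> touches (predC (R x)) w -> incident ends x w].

(** [torso_deg] provides at each vertex of [H] an edge other than a given [x]; thus the complement
    of [R x] touches every vertex of [H], and a vertex of [H] touched by [R x] must be an end of
    [x]. *)
Record torso R H : Prop := Torso {
  torso_wf : wf_graph ends H;
  torso_sub : forall w, w \in gV H -> w \in VG;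
  torso_deg : forall w x, w \in gV H ->
    exists y, [/\ y \in gE H, y != x & incident ends y w];
  torso_stands : forall x, x \in gE H -> stands_for R x;
  torso_cover : forall g, g \in EG -> exists x, x \in gE H /\ R x g;
  torso_inj : forall g x y, x \in gE H -> y \in gE H -> R x g -> R y g -> x = y
}.

Lemma torso_incident R H x w : torso R H -> x \in gE H -> incident ends x w ->
  w \in gV H.
Proof. by move=> tH xH /incident_joins[z] /(wf_joins (torso_wf tH) xH)[]. Qed.

Lemma torso_sep2 R H x u v : torso R H -> x \in gE H -> joins ends x u v ->
  sep2 (R x) u v.
Proof.
move=> tH xH xuv; have [uH vH uv] := wf_joins (torso_wf tH) xH xuv.
split; rewrite ?(torso_sub tH) // => w h1 h2.
by apply: joins_incident xuv _; case: (torso_stands tH xH) => _ _; apply.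
Qed.

Lemma torso_touchC R H x y w : torso R H -> x \in gE H -> y \in gE H ->
  x != y -> touches (R y) w -> touches (predC (R x)) w.
Proof.
move=> tH xH yH xy /touchesP[g [gE Ryg gw]]; apply/touchesP; exists g; split=> //=.
by apply: contra xy => Rxg; rewrite (torso_inj tH xH yH Rxg Ryg).
Qed.

Lemma torso_touch_end R H x w : torso R H -> x \in gE H -> w \in gV H ->
  touches (R x) w -> incident ends x w.
Proof.
move=> tH xH wH Rw; have [y [yH yx yw]] := torso_deg tH x wH.
have [_ _ h] := torso_stands tH xH; apply: h => //.
apply: (torso_touchC tH xH yH); first by rewrite eq_sym.
by have [_ h _] := torso_stands tH yH; apply: h.
Qed.

Lemma torso_inner R H x w : torso R H -> x \in gE H -> w \notin gV H ->
  touches (R x) w -> inner (R x) w.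
Proof.
move=> tH xH wH Rw; rewrite /inner Rw /=; apply: contra wH => nRw.
by apply: (torso_incident tH xH); have [_ _ h] := torso_stands tH xH; apply: h.
Qed.

Lemma torso_touch_uniq R H x y w : torso R H -> x \in gE H -> y \in gE H ->
  w \notin gV H -> touches (R x) w -> touches (R y) w -> x = y.
Proof.
move=> tH xH yH wH Rx Ry; apply/eqP/idPn => xy.
have /andP[_ /negP[]] := torso_inner tH xH wH Rx.
exact: torso_touchC tH xH yH xy Ry.
Qed.

Lemma torso_touch R H w : torso R H -> w \in VG ->
  exists x, x \in gE H /\ touches (R x) w.
Proof.
move=> tH /degG/touchesP[g [gE _ gw]]; have [x [xH Rx]] := torso_cover tH gE.
by exists x; split=> //; apply/touchesP; exists g.
Qed.

Lemma inner_edge F g p q : g \in EG -> joins ends g p q -> inner F p -> F g.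
Proof.
move=> gE gpq /andP[_ nFp]; apply: contraR nFp => nFg; exact: touchesl gpq.
Qed.

Definition lift_edges R H D g : bool := has (fun x => D x && R x g) (gE H).

Lemma lift_edgesE R H D g x : torso R H -> x \in gE H -> R x g ->
  lift_edges R H D g = D x.
Proof.
move=> tH xH Rx; apply/hasP/idP => [[y yH /andP[Dy Ry]]|Dx].
  by rewrite (torso_inj tH xH yH Rx Ry).
by exists x; rewrite // Dx.
Qed.

(** A vertex of the host graph outside [H] lies strictly inside a unique [R x] and inherits the side
    of [x]. *)
Lemma cut_torso_host R H D c : torso R H -> c \in gV H ->
  (forall x w, x \in gE H -> D x -> touches (R x) w -> w \in gV H) ->
  cut ends (gV H) [pred x in gE H | ~~ D x] c ->
  cut ends VG [pred g in EG | ~~ lift_edges R H D g] c.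
Proof.
move=> tH cH inD; case=> Y [a [b [[aH bH ac bc] Ya Yb clY]]].
(* The side of [x] in [H - c]: for [x] outside [D] the ends other than [c] agree under [Y], and the
   value at [c] is masked. *)
pose val x := ((ends x).1 != c) && Y (ends x).1 || ((ends x).2 != c) && Y (ends x).2.
pose X z := if z \in gV H then Y z
            else has (fun x => touches (R x) z && val x) (gE H).
have XE x p : x \in gE H -> ~~ D x -> p != c -> touches (R x) p -> X p = val x.
  move=> xH nDx pc Rp; rewrite /X; case: ifPn => pH.
    have [p' xpp'] := incident_joins (torso_touch_end tH xH pH Rp).
    have -> : val x = Y p || (p' != c) && Y p'.
      by rewrite /val; move: xpp'; rewrite /joins => /orP[]/eqP-> /=; rewrite pc //= orbC.
    have [_|p'c] /= := eqVneq p' c; first by rewrite orbF.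
    have xm : [pred x in gE H | ~~ D x] x by rewrite /= xH.
    apply/idP/orP => [->|[//|]]; first by left.
    by apply: (clY x) p'c pc; rewrite // joinsC.
  apply/hasP/idP => [[y yH /andP[Ry]]|vx].
    by rewrite (torso_touch_uniq tH xH yH pH Rp Ry).
  by exists x; rewrite // Rp.
exists X, a, b; rewrite /X aH bH; split; rewrite ?(torso_sub tH) //.
move=> g p q /andP[gE nDg] gpq pc qc; rewrite -!/(X _).
have [x [xH Rx]] := torso_cover tH gE.
rewrite (lift_edgesE _ tH xH Rx) in nDg.
by rewrite !(XE x) // ?(touchesl gE Rx gpq) ?(touchesr gE Rx gpq).
Qed.

(** The side [X] is restricted to [H]. Biconnectivity of the host graph ensures that both sides
    reach [H] and that a kept edge [x] has no ends on different sides. *)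
Lemma cut_host_torso R H D c : torso R H -> c \in gV H ->
  (forall x w, x \in gE H -> D x -> touches (R x) w -> w \in gV H) ->
  cut ends VG [pred g in EG | ~~ lift_edges R H D g] c ->
  cut ends (gV H) [pred x in gE H | ~~ D x] c.
Proof.
move=> tH cH inD /cut_sym[X [a [b [[aV bV ac bc] Xa Xb cl]]]].
have clx x g p q : x \in gE H -> ~~ D x -> g \in EG -> R x g ->
    joins ends g p q -> p != c -> q != c -> X p = X q.
  by move=> xH Dx gE Rx; apply: cl; rewrite /= gE (lift_edgesE _ tH xH Rx).
have repr d : d \in VG -> d != c -> exists d', [/\ d' \in gV H, d' != c & X d' = X d].
  move=> dV dc; have [dH|dH] := boolP (d \in gV H); first by exists d.
  have [x [xH Rd]] := torso_touch tH dV.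
  have Dx : ~~ D x by apply: contra dH => Dx; apply: inD Rd.
  apply: NNPP => none.
  have nend w : incident ends x w -> w != c -> X w != X d.
    move=> xw wc; apply/eqP => Xw; case: none; exists w; split=> //.
    exact: torso_incident tH xH xw.
  have [r [rc xr]] : exists r, r != c /\ incident ends x r.
    have xj := joins_ends ends x; have [_ _ pq] := wf_joins (torso_wf tH) xH xj.
    have [pc|pc] := eqVneq (ends x).1 c; last first.
      by exists (ends x).1; rewrite pc (joins_incidentl xj).
    by exists (ends x).2; rewrite -pc eq_sym pq (joins_incidentr xj).
  (* If no end of [x] other than [c] is on the side of [d], the interior vertices of [R x] on that
     side are cut off by [c] alone. *)
  have cV := torso_sub tH cH; apply: (bicG cV).
  exists (fun z => inner (R x) z && (X z == X d)), d, r; split=> //.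
  - by split=> //; apply/(torso_sub tH)/(torso_incident tH xH).
  - by rewrite (torso_inner tH xH dH Rd) eqxx.
  - by rewrite negb_and nend ?orbT.
  move=> g p q gE gpq pc qc /andP[ip /eqP Xp].
  have Rg := inner_edge gE gpq ip.
  have Xq : X q = X d by rewrite -(clx x g p q).
  rewrite Xq eqxx andbT; have Rq := touchesr gE Rg gpq.
  apply: (torso_inner tH xH) => //; apply/negP => qH.
  by have := nend q (torso_touch_end tH xH qH Rq) qc; rewrite Xq eqxx.
have [a' [aH a'c Xa']] := repr a aV ac; have [b' [bH b'c Xb']] := repr b bV bc.
exists X, a', b'; split; rewrite ?Xa' ?Xb' //.
move=> x u v /andP[xH Dx] xuv uc vc; suff -> : X u = X v by [].
apply/eqP/idPn => Xuv.
have [uH vH uv] := wf_joins (torso_wf tH) xH xuv.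
have [_ /(_ u (joins_incidentl xuv))/touchesP[g [gE Rg /incident_joins[w guw]]] _] :=
  torso_stands tH xH.
have [_ wV uw] := wf_joins wfG gE guw.
have Rc p : touches (R x) p -> p != c.
  move=> Rp; apply/eqP => pc; rewrite pc in Rp.
  have := torso_touch_end tH xH cH Rp.
  by case/(joins_incident xuv) => eq_c; rewrite eq_c eqxx in uc vc.
have Rw := touchesr gE Rg guw.
have Xw : X w = X u by rewrite (clx x g u w) //; apply: Rc.
have [uV vV _ sR] := torso_sep2 tH xH xuv.
(* The interior vertices of [R x] on the side of [u] are attached only at [u], and the neighbour [w]
   of [u] along [R x] is one of them; so [u] would be a cut vertex. *)
apply: (bicG uV); exists (fun z => inner (R x) z && (X z == X u)), w, v; split.
- by split=> //; rewrite eq_sym.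
- rewrite Xw eqxx andbT /inner Rw /=; apply/negP => nRw.
  case: (sR w Rw nRw) => eq_w; first by rewrite eq_w eqxx in uw.
  by rewrite -eq_w Xw eqxx in Xuv.
- by rewrite negb_and [X v == _]eq_sym Xuv orbT.
move=> h p q hE hpq pu qu /andP[ip /eqP Xp].
have Rh := inner_edge hE hpq ip; have Rq := touchesr hE Rh hpq.
have Xq : X q = X u.
  by rewrite -Xp (clx x h p q) //; apply: Rc => //; apply: touchesl hpq.
rewrite Xq eqxx andbT /inner Rq /=; apply/negP => nRq.
case: (sR q Rq nRq) => eq_q; first by rewrite eq_q eqxx in qu.
by rewrite -eq_q Xq eqxx in Xuv.
Qed.

Lemma torso_no_cut R H c : torso R H -> c \in gV H ->
  ~ cut ends (gV H) (mem (gE H)) c.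
Proof.
move=> tH cH hc; apply: (bicG (torso_sub tH cH)).
apply: sub_cut (cut_torso_host (D := pred0) tH cH _ _) => //.
  by move=> g /= gE; rewrite [_ \in _]gE; apply/hasPn.
by apply: sub_cut hc => x /=; rewrite andbT.
Qed.

End Torsos.

(** * Small cardinalities of finite sets *)

Lemma card_fset_ge2 (K : choiceType) (A : {fset K}) x y :
  x \in A -> y \in A -> x != y -> 2 <= #|` A|.
Proof.
move=> xA yA xy; have: [fset x; y] `<=` A.
  by apply/fsubsetP => z; rewrite !inE => /orP[]/eqP->.
by move/fsubset_leq_card; rewrite cardfs2 xy.
Qed.

Lemma card_fset_lt2 (K : choiceType) (A : {fset K}) x y :
  ~~ (2 <= #|` A|) -> x \in A -> y \in A -> x = y.
Proof. by move=> A2 xA yA; apply/eqP; apply: contraR A2; apply: card_fset_ge2. Qed.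

Lemma fset_ge2_other (K : choiceType) (A : {fset K}) x :
  2 <= #|` A| -> exists y, y \in A /\ y != x.
Proof.
move=> A2; have : 0 < #|` A `\ x| by move: (cardfsD1 x A) A2; case: (x \in A) => /= -> //; lia.
by rewrite cardfs_gt0 => /fset0Pn[y]; rewrite !inE => /andP[yx yA]; exists y.
Qed.

Lemma fset_ge3_other (K : choiceType) (A : {fset K}) (x y : K) :
  2 < #|` A| -> exists z, [/\ z \in A, z != x & z != y].
Proof.
move=> A3; have [z [zA zy]] : exists z, z \in A `\ x /\ z != y.
  by apply: fset_ge2_other; move: A3; rewrite (cardfsD1 x A); case: (x \in A) => //= /ltnW.
by move: zA; rewrite in_fsetD1 => /andP[zx zA]; exists z.
Qed.

(** * Paths, cycles and separation classes *)

Section Paths.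
Variables (T E : choiceType) (ends : lab E -> T * T).
Implicit Types (e f g x y : lab E) (a b c p q u v w z : T) (H : graph T E).
Implicit Types (s t : seq (lab E * T)).

Lemma walk_cat H z s t :
  walk ends H z (s ++ t) <->
  walk ends H z s /\ walk ends H (last z (map snd s)) t.
Proof.
elim: s z => [|[e y] s IH] z /=; first by split=> [|[]].
by split=> [[? ? /IH[]] | [[? ? ?] ?]]; do ?split=> //; apply/IH.
Qed.

Lemma walk_sub H (H' : graph T E) z s :
  (forall e, e \in map fst s -> e \in gE H') ->
  walk ends H z s -> walk ends H' z s.
Proof.
elim: s z => [//|[e y] s IH] z /= sub [eH ej ws]; split=> //.
  by apply: sub; rewrite mem_head.
by apply: IH => // f fs; apply: sub; rewrite inE fs orbT.
Qed.

Lemma walk_incident H z s e w : walk ends H z s -> e \in map fst s ->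
  incident ends e w -> w \in z :: map snd s.
Proof.
elim: s z => [//|[f y] s IH] z /= [_ fj /IH IHs]; rewrite inE => /orP[/eqP->|es ew].
  by case/(joins_incident fj)=> ->; rewrite !inE eqxx ?orbT.
by rewrite inE IHs ?orbT.
Qed.

Lemma walk_rev H z s : walk ends H z s ->
  exists t, [/\ walk ends H (last z (map snd s)) t,
    last (last z (map snd s)) (map snd t) = z,
    map fst t = rev (map fst s) &
    last z (map snd s) :: map snd t = rev (z :: map snd s)].
Proof.
elim: s z => [|[e y] s IH] z /=; first by exists [::].
case=> eH ej /IH[t [wt lt ft st]]; exists (rcons t (e, z)); split.
- by rewrite -cats1; apply/walk_cat; split=> //=; rewrite lt joinsC.
- by rewrite map_rcons last_rcons.
- by rewrite map_rcons ft rev_cons.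
by rewrite map_rcons -rcons_cons st [in RHS]rev_cons.
Qed.

Lemma perm_belast_closed (z : T) (l : seq T) : last z l = z -> perm_eq (belast z l) l.
Proof.
move=> lz; have := lastI z l; rewrite lz => eql.
have: perm_eq (z :: belast z l) (z :: l) by rewrite eql perm_sym perm_rcons.
by rewrite perm_cons.
Qed.

Lemma closed_path H z s : s != [::] -> walk ends H z s -> uniq (map fst s) ->
  uniq (map snd s) -> last z (map snd s) = z -> is_path ends H z s.
Proof.
by move=> s0 ws uf us lz; split=> //; rewrite (perm_uniq (perm_belast_closed lz)).
Qed.

(** What a cycle leaves when its edge [e] is taken out. Merging two cycles concatenates two of
    these. *)
Definition hamilton_path H e u v s : Prop :=
  [/\ [/\ walk ends H u s, last u (map snd s) = v & 2 <= size s],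
      uniq (map fst s), uniq (u :: map snd s),
      (forall x, (x \in gE H) = (x == e) || (x \in map fst s)) /\
      e \notin map fst s &
      forall w, (w \in gV H) = (w \in u :: map snd s)].

Lemma cycle_open H e : is_cycle ends H -> e \in gE H ->
  exists u v s, joins ends e u v /\ hamilton_path H e u v s.
Proof.
case=> x0 [s [[s0 ws uf us _] lz sz eS vS]] eH.
have /mapP[[e' y] es /= ee'] := (eS e).1 eH; subst e'.
case/splitPr: es ws uf us lz sz eS vS => s1 s2 ws uf us lz sz eS vS.
have [w1 /= [_ ej w2]] := (walk_cat _ _ _ _).1 ws.
rewrite map_cat last_cat /= in lz.
(* The closed path is rotated so that [e] comes first; the rest, [s2 ++ s1], runs from [y] round to
   the other end of [e]. *)
have pf : perm_eq (e :: map fst (s2 ++ s1)) (map fst (s1 ++ (e, y) :: s2)).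
  by rewrite !map_cat /= perm_sym perm_catC /= perm_cons perm_refl.
have ps : perm_eq (y :: map snd (s2 ++ s1)) (map snd (s1 ++ (e, y) :: s2)).
  by rewrite !map_cat /= perm_sym perm_catC /= perm_cons perm_refl.
have ufe : uniq (e :: map fst (s2 ++ s1)) by rewrite (perm_uniq pf).
have ll : last y (map snd (s2 ++ s1)) = last x0 (map snd s1).
  by rewrite map_cat last_cat lz.
exists y, (last x0 (map snd s1)), (s2 ++ s1); split; first by rewrite joinsC.
split=> //.
- split=> //; first by apply/walk_cat; rewrite lz.
  by move: sz; rewrite !size_cat /= addnS addnC.
- by case/andP: ufe.
- by rewrite (perm_uniq ps).
- split; last by case/andP: ufe.
  move=> x; rewrite -in_cons (perm_mem pf); apply/idP/idP; apply eS.
by move=> w; rewrite (perm_mem ps); apply/idP/idP; apply vS.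
Qed.

Lemma hamilton_path_rev H e u v s : hamilton_path H e u v s ->
  exists t, hamilton_path H e v u t.
Proof.
case=> -[ws lz sz] uf us [eS es] vS; have [t [wt lt ft st]] := walk_rev ws.
rewrite lz in wt lt st; exists t; split; rewrite ?st ?ft ?rev_uniq //.
- by split=> //; rewrite -(size_map fst) ft size_rev size_map.
- by rewrite mem_rev; split=> // x; rewrite eS mem_rev.
by move=> w; rewrite vS mem_rev.
Qed.

Lemma cycle_hamilton_path H e u v : is_cycle ends H -> e \in gE H ->
  joins ends e u v -> exists s, hamilton_path H e u v s.
Proof.
move=> cH eH euv; have [u' [v' [s [e'uv hs]]]] := cycle_open cH eH.
move: euv e'uv; rewrite /joins => /orP[]/eqP-> /orP[]/eqP[? ?]; subst.
- by exists s.
- exact: hamilton_path_rev hs.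
- exact: hamilton_path_rev hs.
by exists s.
Qed.

(** Without [e], its end [u] keeps a single neighbour [z1]. Deleting [z1] isolates [u], and length
    at least 3 leaves a further vertex [z2]. *)
Lemma cycle_cut H e : is_cycle ends H -> e \in gE H ->
  exists2 c, c \in gV H & cut ends (gV H) [pred x in gE H | x != e] c.
Proof.
move=> cH eH; have [u [v [s [ej [[ws lz sz] uf us [eS es] vS]]]]] := cycle_open cH eH.
case: s ws lz sz uf us eS es vS => [|[g1 z1] [|[g2 z2] s]] //= ws lz _ uf us eS es vS.
case: ws => g1H g1j [g2H g2j ws].
move: us; rewrite !inE !negb_or => /andP[/and3P[uz1 uz2 us] /andP[/andP[z12 z1s] _]].
exists z1; first by rewrite vS !inE eqxx orbT.
exists (pred1 u), u, z2; split=> /=.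
- by rewrite !vS !inE !eqxx !orbT uz1 (eq_sym z2) z12.
- by rewrite eqxx.
- by rewrite eq_sym.
move=> x p q /andP[xH xe] xpq pz1 qz1 /eqP pu; subst p; exfalso.
move: (xH); rewrite eS (negPf xe) /= inE => /orP[/eqP eg|xs].
  subst x; have [qu|qz] := joins_incident g1j (joins_incidentr xpq).
    have := joins_incidentr g1j; case/(joins_incident xpq) => eqz.
      by rewrite eqz eqxx in uz1.
    by rewrite eqz eqxx in qz1.
  by rewrite qz eqxx in qz1.
have w2 : walk ends H z1 ((g2, z2) :: s) by [].
have := walk_incident w2 xs (joins_incidentl xpq).
by rewrite !inE (negPf uz1) (negPf uz2) (negPf us).
Qed.

(** The removed edges have the same ends, so the two remaining paths, one run from [u] to [v] and
    the other back, close up; they share only those ends. *)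
Lemma merge_cycles (H1 H2 : graph T E) e1 e2 :
  wf_graph ends H1 -> is_cycle ends H1 -> is_cycle ends H2 ->
  e1 \in gE H1 -> e2 \in gE H2 ->
  (forall w, incident ends e1 w = incident ends e2 w) ->
  (forall x, x \in gE H1 -> x \notin gE H2) ->
  (forall w, w \in gV H1 -> w \in gV H2 -> incident ends e1 w) ->
  is_cycle ends (Defs.merge H1 H2 e1 e2).
Proof.
move=> wf1 c1 c2 e1H e2H e12 dE dV; set M := Defs.merge _ _ _ _.
have e1j := joins_ends ends e1; move: (ends e1).1 (ends e1).2 e1j => u v e1j.
have [uH1 vH1 uv] := wf_joins wf1 e1H e1j.
have e2j : joins ends e2 v u.
  have := joins_incidentl e1j; rewrite e12 => /incident_joins[z e2j].
  have := joins_incidentr e1j; rewrite e12 => /(joins_incident e2j)[vu|->].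
    by rewrite vu eqxx in uv.
  by rewrite joinsC.
have [s [[ws ls sz] ufs uss [eS es] vS]] := cycle_hamilton_path c1 e1H e1j.
have [t [[wt lt tz] uft ust [eT et] vT]] := cycle_hamilton_path c2 e2H e2j.
have eM x : (x \in gE M) = (x \in map fst (s ++ t)).
  rewrite /M /gE /= in_fsetU !in_fsetD1 -![_ \in _.2]/(_ \in gE _) eS eT map_cat mem_cat.
  congr (_ || _).
    by have [->|_] := eqVneq x e1; rewrite ?(negPf es).
  by have [->|_] := eqVneq x e2; rewrite ?(negPf et).
have lz : last u (map snd (s ++ t)) = u by rewrite map_cat last_cat ls.
have ut : u \in map snd t.
  by rewrite -lt; case: (t) tz => [//|[? ?] t'] _ /=; apply: mem_last.
have vs : v \in map snd s.
  by rewrite -ls; case: (s) sz => [//|[? ?] s'] _ /=; apply: mem_last.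
exists u, (s ++ t); split=> //.
- apply: closed_path => //.
  + by case: (s) sz.
  + apply/walk_cat; rewrite ls; split; [move: ws | move: wt]; apply: walk_sub => x xs;
      by rewrite eM map_cat mem_cat xs ?orbT.
  + rewrite map_cat cat_uniq ufs uft andbT /=; apply/hasPn => x xt.
    apply/negP => xs; have := dE x; rewrite eS eT xs xt !orbT => /(_ isT) //.
  move: uss ust; rewrite !cons_uniq => /andP[us uss] /andP[vt ust].
  rewrite map_cat cat_uniq uss ust andbT /=; apply/hasPn => w wt'; apply/negP => ws'.
  have := dV w; rewrite vS vT !inE ws' wt' !orbT => /(_ isT isT).
  by case/(joins_incident e1j) => ew; rewrite ew in ws' wt'; rewrite ?ws' ?wt' in us vt.
- by move: sz tz; rewrite size_cat; lia.
- by move=> x; rewrite eM.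
move=> w; rewrite /M /gV /= in_fsetU -![_ \in _.1]/(_ \in gV _) vS vT !inE map_cat mem_cat.
by split; [case/orP=> /orP[/eqP->|->] | case/orP=> ->]; rewrite ?ut ?vs ?orbT.
Qed.

(** Consecutive edges of the path share an internal vertex, which is neither [u] nor [v], so [P] is
    constant along it. This serves to show that an edge set is a union of separation classes. *)
Lemma same_class_closed H u v (P : pred (lab E)) e f :
  (forall x y w, x \in gE H -> y \in gE H -> incident ends x w ->
     incident ends y w -> w != u -> w != v -> P x -> P y) ->
  same_class ends H u v e f -> P e -> P f.
Proof.
move=> clP [x0 [s [[_ ws _ _ _] nu nv es fs]]].
have clE x y w : x \in gE H -> y \in gE H -> incident ends x w ->
    incident ends y w -> w != u -> w != v -> P x = P y.
  by move=> *; apply/idP/idP; [apply: (clP x y w) | apply: (clP y x w)].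
suff all_eq : exists b : bool, forall x, x \in map fst s -> P x = b.
  by case: all_eq => b Pb; rewrite !Pb.
case: s ws nu nv es fs => [//|[e1 y] s] /= [e1H e1j ws] nu nv _ _.
exists (P e1); move: nu nv; rewrite /internal /=.
have := joins_incidentr e1j; clear e1j.
elim: s e1 y e1H ws => [|[e2 y2] s IH] e1 y e1H /=.
  by move=> _ _ _ _ x; rewrite inE => /eqP->.
case=> e2H e2j ws e1y; rewrite !inE !negb_or => /andP[uy us] /andP[vy vs] x.
have P12 : P e2 = P e1.
  by apply: (clE _ _ y); rewrite ?(joins_incidentl e2j) // eq_sym.
rewrite inE => /orP[/eqP->//|xs]; rewrite -P12.
by apply: (IH e2 y2) => //; apply: joins_incidentr e2j.
Qed.

(** Two edges meeting at [w] form a path, closed if they are parallel, whose only internal vertex is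
    [w]. Unless [w] is [u] or [v], they are in the same class. *)
Lemma sep_witness_shared H u v (E' : {fset lab E}) e f w :
  wf_graph ends H -> sep_witness ends H u v E' ->
  e \in E' -> f \in gE H `\` E' -> incident ends e w -> incident ends f w ->
  w = u \/ w = v.
Proof.
move=> wfH [[_ _ _ /fsubsetP sE clE] _] eE'; rewrite inE => /andP[fE' fH].
have eH := sE e eE'.
move=> /incident_joins[a ewa] /incident_joins[b fwb].
have [_ _ wa] := wf_joins wfH eH ewa; have [_ _ wb] := wf_joins wfH fH fwb.
apply: NNPP => nw; apply: (negP fE'); apply: (clE e f) => //.
have ef : e != f by apply: contraNneq fE' => <-.
have aw : joins ends e a w by rewrite joinsC.
exists a, [:: (e, w); (f, b)]; split; rewrite ?inE ?eqxx ?orbT //.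
- split=> //=; first by rewrite inE ef.
    by rewrite inE wb.
  by rewrite inE eq_sym wa.
- by apply/eqP => uw; apply: nw; left.
by apply/eqP => uw; apply: nw; right.
Qed.

Definition min_deg2 H : Prop := forall w x, w \in gV H ->
  exists y, [/\ y \in gE H, y != x & incident ends y w].

(* The edges on the side of [u] would make {u, c} a separation pair if there
   were two of them. *)
Lemma cut_side_trivial H (X : pred T) c y u v :
  wf_graph ends H -> min_deg2 H -> ~ sep_pair ends H u c ->
  c \in gV H -> y \in gE H -> joins ends y u v -> u != c -> v != c -> X u != X v ->
  (forall e p q, e \in gE H -> e != y -> joins ends e p q -> p != c -> q != c ->
     X p = X q) ->
  exists a : lab E, [/\ a \in gE H, a != y, joins ends a u c,
    (forall e, e \in gE H -> e != y ->
       (forall z, incident ends e z -> z != c -> X z = X u) -> e = a)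
    & forall w, w \in gV H -> w != c -> X w = X u -> w = u].
Proof.
move=> wfH degH nsep cH yH yuv uc vc Xuv cl.
have [uH vH uv] := wf_joins wfH yH yuv.
pose ok z := (z == c) || (X z == X u).
(* The edges other than [y] that run within the side of [u] together with [c]. *)
pose P e := (e != y) && (ok (ends e).1 && ok (ends e).2).
have PE e p q : joins ends e p q -> P e = (e != y) && (ok p && ok q).
  by rewrite /P /joins => /orP[]/eqP-> //=; rewrite (andbC (ok q)).
have Pw e w : e \in gE H -> incident ends e w -> w != c -> w != v ->
    e != y -> X w = X u -> P e.
  move=> eH /incident_joins[q ewq] wc wv ey Xw.
  rewrite (PE _ _ _ ewq) ey /ok Xw eqxx orbT /=.
  have [//|qc] := eqVneq q c; by rewrite -(cl e w q) // Xw eqxx.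
pose E' := [fset e in gE H | P e].
have E'E e : (e \in E') = (e \in gE H) && P e by rewrite !inE.
have vP e : incident ends e v -> ~~ P e.
  move=> /incident_joins[q evq]; rewrite (PE _ _ _ evq) /ok (negPf vc) /= [X v == _]eq_sym.
  by rewrite (negPf Xuv) andbF.
have E'2 : ~~ (2 <= #|` E'|).
  apply/negP => E'2; apply: nsep; exists E'; split; last split=> //.
    split=> //; first by apply/fsubsetP => e; rewrite E'E => /andP[].
    move=> e f eH fH sc; rewrite !E'E eH fH /=.
    apply: same_class_closed sc => {eH fH} {}e {}f w eH fH ew fw wu wc.
    have [q ewq] := incident_joins ew.
    rewrite (PE _ _ _ ewq) {1}/ok (negPf wc) /= => /and3P[ey /eqP Xw okq].
    have wv : w != v by apply: contraNneq Xuv => <-; rewrite Xw.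
    apply: (Pw f w) => //; apply/eqP => fy; rewrite fy in fw.
    by case: (joins_incident yuv fw) => eq_w; rewrite eq_w eqxx in wu wv.
  (* The complement of [E'] contains [y] and a second edge at [v]. *)
  have [b [bH bY bv]] := degH v y vH.
  apply: (@card_fset_ge2 _ _ b y) => //; rewrite in_fsetD E'E.
    by rewrite bH (negPf (vP b bv)).
  by rewrite yH (negPf (vP y (joins_incidentr yuv))).
have [a [aH ay au]] := degH u y uH.
have E'a : a \in E' by rewrite E'E aH /=; apply: (Pw a u).
(* Another vertex [w] on this side would have two edges, both in [E']. *)
have side w : w \in gV H -> w != c -> X w = X u -> w = u.
  move=> wH wc Xw; apply/eqP/idPn => wu.
  have wv : w != v by apply: contraNneq Xuv => <-; rewrite Xw.
  have ny e : incident ends e w -> e != y.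
    by move=> ew; apply/eqP => ey; rewrite ey in ew;
      case: (joins_incident yuv ew) => eq_w; rewrite eq_w eqxx in wu wv.
  have [e1 [e1H _ e1w]] := degH w y wH; have [e2 [e2H e21 e2w]] := degH w e1 wH.
  case/eqP: e21; apply: (card_fset_lt2 E'2); rewrite E'E ?e1H ?e2H /=.
    exact: (Pw e2 w) (ny e2 e2w) Xw.
  exact: (Pw e1 w) (ny e1 e1w) Xw.
exists a; split=> //.
- have [q auq] := incident_joins au; have [_ qH uq] := wf_joins wfH aH auq.
  have [<-//|qc] := eqVneq q c; have Xq := cl a u q aH ay auq uc qc.
  by case/eqP: uq; rewrite (side q).
move=> e eH ey ez; apply: (card_fset_lt2 E'2) => //; rewrite E'E eH /P ey /= /ok.
have ej := joins_ends ends e.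
apply/andP; split; apply/orP.
  have [->|pc] := eqVneq (ends e).1 c; [by left | right].
  by rewrite ez ?(joins_incidentl ej).
have [->|pc] := eqVneq (ends e).2 c; [by left | right].
by rewrite ez ?(joins_incidentr ej).
Qed.

(** In [H - c] the edge [y] is the only link between the two sides. Each side then shrinks to an end
    of [y], joined to [c] by one edge, and [H] is a triangle. *)
Lemma cut_no_sep_pair_cycle H c y :
  wf_graph ends H -> min_deg2 H -> (forall u v, ~ sep_pair ends H u v) ->
  c \in gV H -> y \in gE H -> ~ cut ends (gV H) (mem (gE H)) c ->
  cut ends (gV H) [pred x in gE H | x != y] c -> is_cycle ends H.
Proof.
move=> wfH degH nsep cH yH ncut /cut_sym[X [a0 [b0 [Vab Xa Xb cl]]]].
have cl' e p q : e \in gE H -> e != y -> joins ends e p q -> p != c -> q != c ->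
     X p = X q by move=> eH ey; apply: cl; rewrite /= eH.
have yj := joins_ends ends y; move: (ends y).1 (ends y).2 yj => u v yuv.
have [uH vH uv] := wf_joins wfH yH yuv.
(* Otherwise putting [y] back would not reconnect the two sides, against [ncut]. *)
have [uc vc Xuv] : [/\ u != c, v != c & X u != X v].
  have nall : ~ (u != c -> v != c -> X u = X v).
    move=> Xuv; apply: ncut; exists X, a0, b0; split=> // e p q eH epq pc qc.
    suff -> : X p = X q by [].
    have [ey|ey] := eqVneq e y; last exact: cl' epq pc qc.
    rewrite ey in epq; have [pu|pv] := joins_incident yuv (joins_incidentl epq);
    have [qu|qv] := joins_incident yuv (joins_incidentr epq); subst p q => //.
      exact: Xuv.
    by rewrite Xuv.
  split; apply/negP => h; apply: nall; rewrite ?h //.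
  by move=> _ _; apply/eqP.
have [a [aH ay auc ua uside]] := cut_side_trivial wfH degH (nsep u c) cH yH yuv uc vc Xuv cl'.
have yvu : joins ends y v u by rewrite joinsC.
have Xvu : X v != X u by rewrite eq_sym.
have [b [bH bY bvc vb vside]] := cut_side_trivial wfH degH (nsep v c) cH yH yvu vc uc Xvu cl'.
have Xor w : X w = X u \/ X w = X v by move: Xuv; case: (X w); case: (X u); case: (X v); auto.
have ab : a != b.
  apply/eqP => eab; rewrite -eab in bvc.
  case: (joins_incident auc (joins_incidentl bvc)) => eqv.
    by rewrite eqv eqxx in uv.
  by rewrite eqv eqxx in vc.
exists u, [:: (y, v); (b, c); (a, u)]; split=> //=.
- apply: closed_path => //=.
  + by split=> //; split=> //; split=> //; rewrite joinsC.
  + by rewrite !inE !negb_or eq_sym bY eq_sym ay eq_sym ab.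
  by rewrite !inE !negb_or vc eq_sym uv eq_sym uc.
- move=> e; rewrite !inE; split; last by case/or3P=> /eqP->.
  move=> eH; have [//|ey] := eqVneq e y => /=.
  have [r er rc] : exists2 r, incident ends e r & r != c.
    have ej := joins_ends ends e; have [_ _ pq] := wf_joins wfH eH ej.
    have [pc|pc] := eqVneq (ends e).1 c.
      by exists (ends e).2; rewrite -?pc ?(joins_incidentr ej) // eq_sym.
    by exists (ends e).1; rewrite ?(joins_incidentl ej).
  have Xr z : incident ends e z -> z != c -> X z = X r.
    move=> ez zc; have [s ers] := incident_joins er.
    case: (joins_incident ers ez) => ezr; subst z => //.
    by rewrite (cl' e r s).
  case: (Xor r) => Xru; last first.
    by rewrite (vb e eH ey) ?eqxx // => z ez zc; rewrite (Xr z).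
  by rewrite (ua e eH ey) ?eqxx ?orbT // => z ez zc; rewrite (Xr z).
move=> w; rewrite !inE; split; last by case/or3P=> /eqP->.
move=> wH; have [//|wc] := eqVneq w c; first by rewrite orbT.
by case: (Xor w) => /[dup] Xw; [move/(uside w wH wc) | move/(vside w wH wc)] => ->;
  rewrite eqxx ?orbT.
Qed.

End Paths.

(** * The torso property under splits and merges *)

Section Invariant.
Variables (T E : choiceType) (ends : lab E -> T * T).
Variables (VG : {fset T}) (EG : {fset lab E}).
Hypothesis wfG : wf_graph ends (VG, EG).
Hypothesis bicG : forall c, c \in VG -> ~ cut ends VG (mem EG) c.
Hypothesis degG : min_deg2 ends (VG, EG).
Implicit Types (e f g x y : lab E) (a b c p q u v w z : T) (H : graph T E).
Implicit Types (R : lab E -> pred (lab E)) (S : seq (graph T E)).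

Local Notation touches := (touches ends EG).
Local Notation sep2 := (sep2 ends VG EG).
Local Notation stands_for := (stands_for ends EG).
Local Notation torso := (torso ends VG EG).

Lemma torso_host : torso (fun x g => g == x) (VG, EG).
Proof.
split=> //=.
- move=> x xE; split=> [g /eqP-> //|w xw|w /touchesP[g [gE /eqP-> //]]].
  by apply/touchesP; exists x.
- by move=> g gE; exists g.
by move=> g x y _ _ /eqP<- /eqP.
Qed.

Lemma eq_torso R (R' : lab E -> pred (lab E)) H :
  (forall x, x \in gE H -> R' x = R x) -> torso R H -> torso R' H.
Proof.
move=> eqR [wfH sub deg st cov inj]; split=> //.
- by move=> x xH; rewrite /stands_for eqR //; apply: st.
- by move=> g /cov[x [xH Rx]]; exists x; rewrite eqR.
by move=> g x y xH yH; rewrite !eqR //; apply: inj.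
Qed.

Lemma torso_nonempty R H x : torso R H -> x \in gE H -> exists g, R x g.
Proof.
move=> tH xH; have [_ h _] := torso_stands tH xH.
have /h/touchesP[g [_ Rg _]] := joins_incidentl (joins_ends ends x).
by exists g.
Qed.

Lemma part_gV H (E' : {fset lab E}) u v x w :
  w \in gV (part ends H E' u v x) ->
  [\/ exists2 y, y \in E' & incident ends y w, w = u | w = v].
Proof.
rewrite /part /gV /= !in_fsetU -orbA => /or3P[/imfsetP[y yE' ->]|/imfsetP[y yE' ->]|].
- by apply: Or31; exists y; rewrite // (joins_incidentl (joins_ends ends y)).
- by apply: Or31; exists y; rewrite // (joins_incidentr (joins_ends ends y)).
by rewrite !inE => /orP[]/eqP->; [apply: Or32 | apply: Or33].
Qed.

Lemma part_gVu H (E' : {fset lab E}) u v x w :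
  incident ends x u -> incident ends x v ->
  (w = u \/ w = v) \/ (exists2 y, y \in E' & incident ends y w) ->
  w \in gV (part ends H E' u v x).
Proof.
move=> xu xv; rewrite /part /gV /= !in_fsetU.
case=> [[]->|[y yE' /incident_joins[q]]]; rewrite ?inE ?eqxx ?orbT //.
rewrite /joins => /orP[]/eqP ye; apply/orP; left; apply/orP; [left|right];
  by apply/imfsetP; exists y; rewrite // ye.
Qed.

(** A vertex touched both by [R x] and by the rest is an end of an edge of [H] on either side of the
    split, hence [u] or [v]. Conversely, biconnectivity of the host graph makes both sides touch [u]
    and [v]. *)
Lemma torso_part R H (E' : {fset lab E}) u v x :
  torso R H -> E' `<=` gE H ->
  (forall e f w, e \in E' -> f \in gE H `\` E' -> incident ends e w ->
     incident ends f w -> w = u \/ w = v) ->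
  u \in gV H -> v \in gV H -> u != v ->
  (exists e, e \in E') -> (exists e, e \in gE H `\` E') ->
  x \notin gE H -> joins ends x u v ->
  (forall g, R x g = has (fun y => R y g) (gE H `\` E')) ->
  torso R (part ends H E' u v x).
Proof.
move=> tH /fsubsetP sE' shared uH vH uv [e0 e0E'] [f0 f0E'] xH xuv Rx.
have [xu xv] := (joins_incidentl xuv, joins_incidentr xuv).
have subD y : y \in gE H `\` E' -> y \in gE H by rewrite inE => /andP[].
have notD y : y \in E' -> y \notin gE H `\` E' by rewrite inE => ->.
have Rin g : R x g -> exists2 y, y \in gE H `\` E' & R y g.
  by rewrite Rx => /hasP[y]; exists y.
have Rout g : g \in EG -> ~~ R x g -> exists2 y, y \in E' & R y g.
  move=> gE; rewrite Rx => /hasPn nR; have [y [yH Ry]] := torso_cover tH gE.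
  exists y => //; apply/idPn => yE'; have := nR y; rewrite inE yE' yH Ry => /(_ isT) //.
have RE' y g : y \in E' -> R y g -> ~~ R x g.
  move=> yE' Ry; rewrite Rx; apply/hasPn => y' y'D; apply/negP => Ry'.
  have eqy := torso_inj tH (sE' y yE') (subD _ y'D) Ry Ry'.
  by rewrite eqy in yE'; have := notD _ yE'; rewrite y'D.
have RxE g : R x g -> g \in EG.
  by case/Rin=> y /subD yH Ry; have [h _ _] := torso_stands tH yH; apply: h.
have both w : touches (R x) w -> touches (predC (R x)) w ->
    exists2 y, y \in E' & incident ends y w /\ (w = u \/ w = v).
  case/touchesP=> g [gE Rg gw] /touchesP[h [hE Rh hw]].
  have [y yD Ryg] := Rin g Rg; have [z zE' Rzh] := Rout h hE Rh.
  have yz : y != z by apply/eqP => eqy; move: (notD z zE'); rewrite -eqy yD.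
  have zH := sE' z zE'; have yH := subD y yD.
  have ty : touches (R y) w by apply/touchesP; exists g.
  have tz : touches (R z) w by apply/touchesP; exists h.
  have yw : incident ends y w.
    have [_ _ s] := torso_stands tH yH; apply: s => //.
    exact: torso_touchC tH yH zH yz tz.
  have zw : incident ends z w.
    have [_ _ s] := torso_stands tH zH; apply: s => //.
    by apply: torso_touchC tH zH yH _ ty; rewrite eq_sym.
  by exists z => //; split=> //; apply: shared zE' yD zw yw.
have sx : sep2 (R x) u v.
  by split; rewrite ?(torso_sub tH) // => w h1 h2; have [? _ []] := both w h1 h2.
have [gx Rgx] := torso_nonempty tH (subD _ f0E').
have Rxgx : R x gx by rewrite Rx; apply/hasP; exists f0.
have [gy Rgy] := torso_nonempty tH (sE' _ e0E').
have gyE : gy \in EG by have [h _ _] := torso_stands tH (sE' _ e0E'); apply: h.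
have nRgy := RE' _ _ e0E' Rgy.
have tu : touches (R x) u by apply: (sep2_touches wfG bicG sx (RxE _ Rxgx)).
have tv : touches (R x) v.
  by apply: (sep2_touches wfG bicG (sep2_swap sx) (RxE _ Rxgx)).
have ntu : touches (predC (R x)) u by apply: (sep2_touches wfG bicG (sep2C sx) gyE).
have ntv : touches (predC (R x)) v.
  by apply: (sep2_touches wfG bicG (sep2C (sep2_swap sx)) gyE).
have inE' y : (y \in gE (part ends H E' u v x)) = (y == x) || (y \in E').
  by rewrite /part /gE /= in_fsetU in_fset1.
split.
- move=> y; rewrite inE' => /orP[/eqP->|yE'].
    have xj := joins_ends ends x; split; last 1 first.
    + move: xuv; rewrite /joins => /orP[]/eqP-> //=; by rewrite eq_sym.
    + by apply: part_gVu => //; left; apply: joins_incident xuv (joins_incidentl xj).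
    by apply: part_gVu => //; left; apply: joins_incident xuv (joins_incidentr xj).
  have yj := joins_ends ends y.
  split; last by case: (torso_wf tH (sE' y yE')).
    by apply: part_gVu => //; right; exists y; rewrite // (joins_incidentl yj).
  by apply: part_gVu => //; right; exists y; rewrite // (joins_incidentr yj).
- move=> w /part_gV[[y yE' yw]|->|->]; try exact: (torso_sub tH).
  by apply/(torso_sub tH)/(torso_incident tH (sE' y yE')).
- move=> w y wH.
  (* At [u] and [v] the degree bound comes from [x] and an edge of [E']; at any other vertex of the
     part all edges of [H] belong to [E']. *)
  have end_case : touches (R x) w -> touches (predC (R x)) w ->
      exists z : lab E, [/\ z \in gE (part ends H E' u v x), z != y & incident ends z w].
    move=> t1 t2; have [z zE' [zw wuv]] := both w t1 t2.
    have [->|yx] := eqVneq y x.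
      by exists z; rewrite inE' zE' orbT; split=> //; apply: contraNneq xH => <-; apply: sE'.
    by exists x; rewrite inE' eqxx eq_sym yx; split=> //; case: wuv => ->.
  have [wu|wu] := eqVneq w u; first by apply: end_case; rewrite wu.
  have [wv|wv] := eqVneq w v; first by apply: end_case; rewrite wv.
  case/part_gV: wH => [[z zE' zw]|/eqP|/eqP]; rewrite ?(negPf wu) ?(negPf wv) //.
  have wH := torso_incident tH (sE' z zE') zw.
  have [y' [y'H y'y y'w]] := torso_deg tH y wH.
  exists y'; split=> //; rewrite inE' orbC; have [//|y'E'] := boolP (y' \in E').
  case: (shared z y' w zE' _ zw y'w) => [|/eqP|/eqP]; rewrite ?(negPf wu) ?(negPf wv) //.
  by rewrite inE y'E'.
- move=> y; rewrite inE' => /orP[/eqP->|/sE'/(torso_stands tH)//].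
  split=> // w; first by case/(joins_incident xuv) => ->.
  by move=> h1 h2; have [? _ [_ []->]] := both w h1 h2.
- move=> g gE; have [Rg|nRg] := boolP (R x g); first by exists x; rewrite inE' eqxx.
  by have [y yE' Ry] := Rout g gE nRg; exists y; rewrite inE' yE' orbT.
move=> g y z; rewrite !inE' => /orP[/eqP->|yE'] /orP[/eqP->|zE'] // Ry Rz.
- by have := RE' _ _ zE' Rz; rewrite Ry.
- by have := RE' _ _ yE' Ry; rewrite Rz.
exact: (torso_inj tH (sE' _ yE') (sE' _ zE') Ry Rz).
Qed.

(** At [w] both graphs have an edge besides [e1] and [e2]. What these edges stand for lies in [R e2]
    and [R e1] respectively, so [w] is an attachment of [R e1]. *)
Lemma torso_meet R (H1 H2 : graph T E) e1 e2 w : torso R H1 -> torso R H2 ->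
  e1 \in gE H1 -> e2 \in gE H2 -> {in EG, forall g, R e1 g = ~~ R e2 g} ->
  w \in gV H1 -> w \in gV H2 -> incident ends e1 w.
Proof.
move=> t1 t2 e1H e2H R12 w1 w2.
have [x1 [x1H x1e x1w]] := torso_deg t1 e1 w1; have [x2 [x2H x2e x2w]] := torso_deg t2 e2 w2.
have tx1 : touches (R x1) w by have [_ h _] := torso_stands t1 x1H; apply: h.
have tx2 : touches (R x2) w by have [_ h _] := torso_stands t2 x2H; apply: h.
have [_ _ h] := torso_stands t1 e1H; apply: h.
  rewrite (@eq_touches _ _ _ _ _ (predC (R e2))); last by move=> g gE; rewrite R12.
  by apply: (torso_touchC t2 e2H x2H) => //; rewrite eq_sym.
by apply: (torso_touchC t1 e1H x1H) => //; rewrite eq_sym.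
Qed.

Lemma merge_gE (H1 H2 : graph T E) e1 e2 x :
  (x \in gE (Defs.merge H1 H2 e1 e2)) =
  (x != e1) && (x \in gE H1) || (x != e2) && (x \in gE H2).
Proof. by rewrite /gE /Defs.merge /= in_fsetU !in_fsetD1. Qed.

Lemma merge_gV (H1 H2 : graph T E) e1 e2 w :
  (w \in gV (Defs.merge H1 H2 e1 e2)) = (w \in gV H1) || (w \in gV H2).
Proof. by rewrite /gV /Defs.merge /= in_fsetU. Qed.

Lemma mergeC (H1 H2 : graph T E) e1 e2 :
  Defs.merge H1 H2 e1 e2 = Defs.merge H2 H1 e2 e1.
Proof. by congr pair; apply: fsetUC. Qed.

(** The other edges of [H2] stand for [R e1] and those of [H1] for [R e2], so without [e1] and [e2]
    the remaining sets still partition the host edges. *)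
Lemma torso_merge R (H1 H2 : graph T E) e1 e2 : torso R H1 -> torso R H2 ->
  e1 \in gE H1 -> e2 \in gE H2 -> {in EG, forall g, R e1 g = ~~ R e2 g} ->
  (forall w, incident ends e1 w = incident ends e2 w) ->
  (forall x, x \in gE H1 -> x \notin gE H2) ->
  torso R (Defs.merge H1 H2 e1 e2).
Proof.
move=> t1 t2 e1H e2H R12 i12 dE.
have deg_half (K1 K2 : graph T E) x1 x2 w y : torso R K1 -> torso R K2 ->
    x1 \in gE K1 -> x2 \in gE K2 -> (forall w, incident ends x1 w = incident ends x2 w) ->
    (forall x, x \in gE K1 -> x \notin gE K2) -> w \in gV K1 ->
    exists z : lab E, [/\ z \in gE (Defs.merge K1 K2 x1 x2), z != y & incident ends z w].
  move=> {}t1 {}t2 x1K x2K {}i12 {}dE wK.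
  have [x1w|x1w] := boolP (incident ends x1 w); last first.
    have [z [zK zy zw]] := torso_deg t1 y wK; exists z; split=> //.
    rewrite merge_gE zK andbT; apply/orP; left.
    by apply: contraNneq x1w => <-.
  have [z1 [z1K z1x z1w]] := torso_deg t1 x1 wK.
  have wK2 : w \in gV K2 by apply: (torso_incident t2 x2K); rewrite -i12.
  have [z2 [z2K z2x z2w]] := torso_deg t2 x2 wK2.
  (* If the edge found in the first graph is the forbidden [y], the one from the second graph
     differs from it, the edge sets being disjoint. *)
  have [yz|yz] := eqVneq z1 y; last by exists z1; rewrite merge_gE z1K z1x.
  exists z2; rewrite merge_gE z2K z2x orbT; split=> //.
  by apply: contraTneq z2K => ->; rewrite -yz; apply: dE.
split.
- move=> x; rewrite merge_gE !merge_gV => /orP[]/andP[_ xH].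
    by have [-> -> ->] := torso_wf t1 xH.
  by have [-> -> ->] := torso_wf t2 xH; rewrite ?orbT.
- by move=> w; rewrite merge_gV => /orP[]; [apply: (torso_sub t1) | apply: (torso_sub t2)].
- move=> w y; rewrite merge_gV => /orP[] wH; first exact: deg_half t1 t2 e1H e2H i12 dE wH.
  rewrite mergeC; apply: deg_half t2 t1 e2H e1H _ _ wH; first by move=> z; rewrite i12.
  by move=> x x2; apply: contraL x2; apply: dE.
- by move=> x; rewrite merge_gE => /orP[]/andP[_] xH; [apply: (torso_stands t1) | apply: (torso_stands t2)].
- move=> g gE; have [Rg|nRg] := boolP (R e1 g).
    have nR2 : ~~ R e2 g by rewrite -R12.
    have [x [xH Rx]] := torso_cover t2 gE; exists x; split=> //.
    rewrite merge_gE xH andbT orbC; apply/orP; left.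
    by apply: contraNneq nR2 => <-.
  have [x [xH Rx]] := torso_cover t1 gE; exists x; split=> //.
  rewrite merge_gE xH andbT; apply/orP; left.
  by apply: contraNneq nRg => <-.
have cross x y g : x != e1 -> x \in gE H1 -> y != e2 -> y \in gE H2 -> R x g -> R y g -> False.
  move=> xe xH ye yH Rx Ry.
  have gE : g \in EG by have [h _ _] := torso_stands t1 xH; apply: h.
  have n1 : ~~ R e1 g by apply: contra xe => Re; rewrite (torso_inj t1 xH e1H Rx Re).
  move: n1; rewrite R12 // negbK => Re2.
  by rewrite (torso_inj t2 yH e2H Ry Re2) eqxx in ye.
move=> g x y; rewrite !merge_gE => /orP[]/andP[xe xH] /orP[]/andP[ye yH] Rx Ry.
- exact: (torso_inj t1 xH yH Rx Ry).
- by case: (cross x y g).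
- by case: (cross y x g).
exact: (torso_inj t2 xH yH Rx Ry).
Qed.

End Invariant.

(** * The invariant of the whole list of components *)

Section Decompositions.
Variables (T E : choiceType) (ends : lab E -> T * T).
Variables (VG : {fset T}) (EG : {fset lab E}).
Hypothesis wfG : wf_graph ends (VG, EG).
Hypothesis bicG : forall c, c \in VG -> ~ cut ends VG (mem EG) c.
Hypothesis degG : min_deg2 ends (VG, EG).
Hypothesis nonvirtualG : forall g, g \in EG -> nonvirtual g.
Implicit Types (e f g x y : lab E) (w : T) (H : graph T E).
Implicit Types (R : lab E -> pred (lab E)) (S : seq (graph T E)).

Local Notation torso := (torso ends VG EG).
Local Notation virt := (virt E).

Lemma virt_eq k k' b b' : (virt k b == virt k' b') = (k == k') && (b == b').
Proof. by apply/eqP/andP => [[-> ->]|[/eqP-> /eqP->]]. Qed.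

(** Counted along the list: components are told apart by position, not by value. *)
Definition occurrences S x : nat := count (fun H => x \in gE H) S.

(** The last clause keeps the fact that a split has two edges on each side; it supplies the second
    edge needed to exclude separators across a virtual edge. *)
Definition complementary R k : Prop :=
  [/\ {in EG, forall g, R (virt k true) g = ~~ R (virt k false) g},
      forall w, incident ends (virt k true) w = incident ends (virt k false) w
    & forall b, exists g1 g2, [/\ R (virt k b) g1, R (virt k b) g2 & g1 != g2]].

(** By [dec_uniq] and [dec_pair] a virtual edge and its partner occur once each or not at all. The
    bound in [dec_compl] comes from the two edges of a split side plus the new virtual edge. *)
Record decomposition R S : Prop := Decomposition {
  dec_nonvirtual : forall (e : E) g, R (inl e) g = (g == inl e);
  dec_torso : forall H, H \in S -> torso R H;
  dec_compl : forall H k b, H \in S -> virt k b \in gE H ->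
    complementary R k /\ 2 < #|` gE H|;
  dec_uniq : forall x, occurrences S x <= 1;
  dec_pair : forall k b, occurrences S (virt k b) = occurrences S (virt k (~~ b));
  dec_cover : forall g, g \in EG -> 0 < occurrences S g
}.

Lemma decomposition_host : decomposition (fun x g => g == x) [:: (VG, EG)].
Proof.
have nvirt k b : (virt k b \in EG) = false.
  by apply/negP => /nonvirtualG[].
split=> //=.
- by move=> H; rewrite inE => /eqP->; apply: torso_host.
- by move=> H k b; rewrite inE => /eqP-> /=; rewrite /gE /= nvirt.
- by move=> x; rewrite /occurrences /= addn0 leq_b1.
- by move=> k b; rewrite /occurrences /= /gE /= !nvirt.
by move=> g gE; rewrite /occurrences /= /gE /= gE.
Qed.

Lemma complementary_corr R k b : complementary R k ->
  {in EG, forall g, R (virt k b) g = ~~ R (virt k (~~ b)) g}.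
Proof. by case=> h _ _ g gE; case: b => /=; rewrite h ?negbK. Qed.

Lemma complementary_incident R k b w : complementary R k ->
  incident ends (virt k b) w = incident ends (virt k (~~ b)) w.
Proof. by case=> _ h _; case: b => /=; rewrite h. Qed.

(** [R] changes only at the two fresh labels, which occur in no old component; all earlier facts
    therefore carry over. *)
Lemma split_decomposition R S S' : decomposition R S -> split_step ends S S' ->
  exists R', decomposition R' S'.
Proof.
case=> nv tor compl un pr cov [S1 [S2 [H [u [v [E' [k [[eqS wit fr jt jf] eqS']]]]]]]].
have HS : H \in S by rewrite eqS mem_cat mem_head orbT.
have tH := tor H HS.
have shared e f w : e \in E' -> f \in gE H `\` E' -> incident ends e w ->
    incident ends f w -> w = u \/ w = v.
  exact: sep_witness_shared (torso_wf tH) wit.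
have [[uH vH uv sE' _] [E'2 D2]] := wit.
set D := gE H `\` E' in shared D2 eqS'.
have DE' : gE H `\` D = E' by rewrite fsetDK.
have inH x : (x \in gE H) = (x \in E') || (x \in D).
  rewrite /D in_fsetD; have [/(fsubsetP sE')->|] //= := boolP (x \in E').
have tf : virt k true != virt k false by apply/eqP.
(* [virt k true] is added to the part with edges [E'], so it stands for the other part [D]; and vice
   versa. *)
pose R' x := if x == virt k true then fun g => has (fun y => R y g) D
             else if x == virt k false then fun g => has (fun y => R y g) E' else R x.
have R't g : R' (virt k true) g = has (fun y => R y g) D by rewrite /R' eqxx.
have R'f g : R' (virt k false) g = has (fun y => R y g) E'.
  by rewrite /R' eq_sym (negPf tf) eqxx.
have ktN b K : K \in S -> virt k b \notin gE K by move=> KS; apply: fr.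
have R'S K x : K \in S -> x \in gE K -> R' x = R x.
  move=> KS xK; rewrite /R' !ifF //; apply/negbTE; apply: contraTneq xK => ->; exact: ktN.
have tS K : K \in S -> torso R' K.
  by move=> KS; apply: eq_torso (tor K KS) => x; apply: R'S.
have tH' := tS H HS.
(* The label is a dummy: any element of the set will do. *)
have [e0 [e0E' _]] := fset_ge2_other (virt k true) E'2.
have [f0 [f0D _]] := fset_ge2_other (virt k true) D2.
have t1 : torso R' (part ends H E' u v (virt k true)).
  apply: torso_part => //; [by exists e0 | by exists f0 | exact: ktN |].
  move=> g; rewrite R't; apply: eq_in_has => y yD.
  by rewrite (R'S H) // inH yD orbT.
have t2 : torso R' (part ends H D u v (virt k false)).
  apply: torso_part => //; rewrite ?DE'.
  - exact: fsubsetDl.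
  - by move=> e f w eD fE' ew fw; apply: (shared f e).
  - by exists f0.
  - by exists e0.
  - exact: ktN.
  move=> g; rewrite R'f; apply: eq_in_has => y yE'.
  by rewrite (R'S H) // inH yE'.
have g1E x : (x \in gE (part ends H E' u v (virt k true))) = (x == virt k true) || (x \in E').
  by rewrite /part /gE /= in_fsetU in_fset1.
have g2E x : (x \in gE (part ends H D u v (virt k false))) = (x == virt k false) || (x \in D).
  by rewrite /part /gE /= in_fsetU in_fset1.
have two (A : {fset lab E}) : A `<=` gE H -> 2 <= #|` A| ->
    exists g1 g2, [/\ has (fun y => R y g1) A, has (fun y => R y g2) A & g1 != g2].
  move=> /fsubsetP sA A2; have [x1 [x1A _]] := fset_ge2_other (virt k true) A2.
  have [x2 [x2A x21]] := fset_ge2_other x1 A2.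
  have [g1 Rg1] := torso_nonempty tH (sA _ x1A).
  have [g2 Rg2] := torso_nonempty tH (sA _ x2A).
  exists g1, g2; split; [by apply/hasP; exists x1 | by apply/hasP; exists x2 |].
  by apply: contra x21 => /eqP eg; apply/eqP/(torso_inj tH (sA _ x2A) (sA _ x1A) Rg2); rewrite -eg.
have compk : complementary R' k.
  split.
  - move=> g gE; rewrite R't R'f; apply/hasP/hasPn => [[y yD Ry] z zE'|nR].
      apply/negP => Rz; have yz : y = z by apply: (torso_inj tH _ _ Ry Rz); rewrite inH ?yD ?zE' ?orbT.
      by move: yD; rewrite /D in_fsetD yz zE'.
    have [y [yH Ry]] := torso_cover tH gE; exists y => //.
    move: yH; rewrite inH => /orP[yE'|//]; by have := nR y yE'; rewrite Ry.
  - move=> w; apply/idP/idP => [/(joins_incident jt)|/(joins_incident jf)] [] ->;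
      by rewrite ?(joins_incidentl jt) ?(joins_incidentr jt) ?(joins_incidentl jf) ?(joins_incidentr jf).
  case.
    have [||g1 [g2 [? ? ?]]] := two D; rewrite // ?fsubsetDl //.
    by exists g1, g2; rewrite !R't.
  have [||g1 [g2 [? ? ?]]] := two E' => //.
  by exists g1, g2; rewrite !R'f.
have mem' K : K \in S' -> [\/ K \in S, K = part ends H E' u v (virt k true)
                           | K = part ends H D u v (virt k false)].
  rewrite eqS' eqS !mem_cat !inE => /or4P[->|/eqP->|/eqP->|->];
    by [apply: Or31; rewrite ?orbT | apply: Or32 | apply: Or33].
have compO K k' b : K \in S -> virt k' b \in gE K -> complementary R' k'.
  move=> KS kK; have [[h1 h2 h3] _] := compl _ _ _ KS kK.
  have kk b' : R' (virt k' b') = R (virt k' b').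
    have nk : k' != k by apply: contraTneq kK => ->; apply: ktN.
    by rewrite /R' !ifF //; apply/eqP; case=> eqk; rewrite eqk eqxx in nk.
  by split=> [g gE||b'] //; rewrite ?kk; [apply: h1 | apply: h3].
have card_part (A : {fset lab E}) x : x \notin gE H -> A `<=` gE H -> 2 <= #|` A| ->
    2 < #|` gE (part ends H A u v x)|.
  move=> xH /fsubsetP sA A2; rewrite /part /gE /= cardfsU1.
  by rewrite (contra (sA x)).
have occ x : occurrences S' x =
    (occurrences S x + (x == virt k true) + (x == virt k false))%N.
  rewrite eqS eqS' /occurrences !count_cat /= g1E g2E inH.
  have [->|xt] := eqVneq x (virt k true).
    have := ktN true H HS; rewrite inH (negPf tf) => /norP[/negPf-> /negPf->] /=.
    by rewrite ?addn0 ?addn1 ?add0n ?add1n ?addnS.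
  have [->|xf] := eqVneq x (virt k false).
    have := ktN false H HS; rewrite inH => /norP[/negPf-> /negPf->] /=.
    by rewrite ?addn0 ?addn1 ?add0n ?add1n ?addnS.
  by rewrite /D in_fsetD; case: (x \in E') (fsubsetP sE' x) => [/(_ isT)->|_] /=;
    by rewrite !addn0 ?add0n.
have occk b : occurrences S (virt k b) = 0.
  by apply/eqP; rewrite -leqn0 leqNgt -has_count; apply/hasPn => K; apply: ktN.
exists R'; split.
- by move=> e g; apply: nv.
- by move=> K /mem'[/tS//|->|->].
- move=> K k' b /mem'[KS kK|->|->].
  + split; first exact: compO kK.
    by have [] := compl _ _ _ KS kK.
  + rewrite g1E => kk; split; last by apply: card_part => //; apply: ktN.
    case/orP: kk => [/eqP[->] //|kE']; apply: (compO H k' b) => //.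
    by rewrite inH kE'.
  rewrite g2E => kk; split; last by apply: card_part; rewrite ?fsubsetDl //; apply: ktN.
  case/orP: kk => [/eqP[->] //|kE']; apply: (compO H k' b) => //.
  by rewrite inH kE' orbT.
- move=> x; rewrite occ; have [->|xt] := eqVneq x (virt k true).
    by rewrite occk (negPf tf).
  have [->|xf] := eqVneq x (virt k false); first by rewrite occk.
  by rewrite !addn0.
- move=> k' b; rewrite !occ pr -!addnA; congr (_ + _)%N.
  by rewrite !virt_eq; case: b; rewrite !andbT !andbF addnC.
by move=> g /cov; rewrite occ -addnA; apply: ltn_addr.
Qed.

Lemma merge_decomposition R S S' : decomposition R S -> merge_step ends S S' ->
  decomposition R S' /\
  exists H1 H2 e1 e2, [/\ H1 \in S /\ H2 \in S, e1 \in gE H1 /\ e2 \in gE H2,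
    mergeable ends H1 H2,
    {in S', forall H, H \in S \/ H = Defs.merge H1 H2 e1 e2} &
    [/\ {in EG, forall g, R e1 g = ~~ R e2 g},
      forall w, incident ends e1 w = incident ends e2 w,
      forall x, x \in gE H1 -> x \notin gE H2 &
      2 < #|` gE (Defs.merge H1 H2 e1 e2)| ]].
Proof.
case=> nv tor compl un pr cov.
case=> S1 [S2 [S3 [H1 [H2 [e1 [e2 [[eqS e1H e2H cor mrg] eqS']]]]]]].
have H1S : H1 \in S by rewrite eqS mem_cat mem_head orbT.
have H2S : H2 \in S by rewrite eqS !(mem_cat, inE) eqxx !orbT.
have mem' : {in S', forall H, H \in S \/ H = Defs.merge H1 H2 e1 e2}.
  move=> H; rewrite eqS' eqS !(mem_cat, inE) => /or4P[->|/eqP->|->|->]; rewrite ?orbT; auto.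
have [k [b [ek1 ek2]]] := cor.
have [ck card1] : complementary R k /\ 2 < #|` gE H1| by apply: (compl H1 k b); rewrite -?ek1.
have [_ card2] : complementary R k /\ 2 < #|` gE H2| by apply: (compl H2 k (~~ b)); rewrite -?ek2.
have R12 : {in EG, forall g, R e1 g = ~~ R e2 g}.
  by rewrite ek1 ek2; apply: complementary_corr.
have i12 w : incident ends e1 w = incident ends e2 w.
  by rewrite ek1 ek2; apply: complementary_incident ck.
have dE x : x \in gE H1 -> x \notin gE H2.
  move=> x1; apply/negP => x2; have := un x; rewrite eqS /occurrences !count_cat /= count_cat /= x1 x2.
  by rewrite !add1n !addnS.
have tM := torso_merge (tor _ H1S) (tor _ H2S) e1H e2H R12 i12 dE.
have e12 : e1 != e2 by apply: contraTneq e2H => <-; apply: dE.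
have cardM : 2 < #|` gE (Defs.merge H1 H2 e1 e2)|.
  rewrite /gE /= cardfsU (_ : _ `&` _ = fset0) ?cardfs0.
    move: card1 card2; rewrite (cardfsD1 e1 (gE H1)) (cardfsD1 e2 (gE H2)) e1H e2H /gE.
    by clear; lia.
  apply/fsetP => x; rewrite in_fsetI !in_fsetD1 in_fset0 -!/(gE _).
  by apply/negP => /andP[/andP[_ /dE/negPf->]]; rewrite andbF.
(* A merge removes one occurrence of each of two partners, so the counts of partners stay equal. *)
have occ x : (occurrences S' x + (x == e1) + (x == e2))%N = occurrences S x.
  rewrite eqS eqS' /occurrences !count_cat /= !count_cat /= merge_gE.
  have [->|x1] := eqVneq x e1.
    by rewrite e1H (negPf (dE _ e1H)) (negPf e12) /= addn0 addn1 !addnS.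
  have [->|x2] := eqVneq x e2.
    have /negPf-> : e2 \notin gE H1 by apply: contraL e2H; apply: dE.
    by rewrite e2H andbF /= addn0 addn1 !addnS.
  by case: (x \in gE H1) (dE x) => [/(_ isT)/negPf->|_] /=;
    rewrite !addn0 // !add0n; case: (x \in gE H2); by rewrite ?add1n ?addnS ?add0n.
split; last by exists H1, H2, e1, e2.
split=> //.
- by move=> H /mem'[/tor//|->].
- move=> H k' b' /mem'[HS kH|->]; first exact: compl kH.
  rewrite merge_gE => kM; split=> //.
  by case/orP: kM => /andP[_ kH]; [case: (compl _ _ _ H1S kH) | case: (compl _ _ _ H2S kH)].
- by move=> x; have := un x; rewrite -occ -addnA; apply: leq_trans; rewrite leq_addr.
- move=> k' b'; have := pr k' b'; rewrite -!occ ek1 ek2 -!addnA.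
  have -> : ((virt k' b' == virt k b) + (virt k' b' == virt k (~~ b)) =
     (virt k' (~~ b') == virt k b) + (virt k' (~~ b') == virt k (~~ b)))%N.
    by rewrite !virt_eq; case: (k' == k); case: b'; case: (b).
  by move/addIn.
move=> g gE; have := cov g gE; rewrite -occ; have [e ->] := nonvirtualG gE.
by rewrite ek1 ek2 /= !addn0.
Qed.

(** Splitting ends without separation pairs, but merging brings them back, as in a cycle of length
    at least 4. This trichotomy survives merging. *)
Definition classified H : Prop :=
  [\/ is_cycle ends H, exists k, kedge k H | forall u v, ~ sep_pair ends H u v].

(** Cycles merge to a cycle. Two multi-edges share both ends of the merged edge, so their union has
    the same two vertices. *)
Lemma merge_classified R S S' : decomposition R S -> merge_step ends S S' ->
  {in S, forall H, classified H} -> {in S', forall H, classified H}.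
Proof.
move=> dS st cS; have [_ [H1 [H2 [e1 [e2 [[H1S H2S] [e1H e2H] mrg mem' [R12 i12 dE card]]]]]]] :=
  merge_decomposition dS st.
have [t1 t2] := (dec_torso dS H1S, dec_torso dS H2S).
move=> H /mem'[/cS//|->]; case: mrg => [[c1 c2]|[k1 [k2 [[v1 _ _] [v2 _ _]]]]].
  apply: Or31; apply: merge_cycles => //; first exact: torso_wf t1.
  by move=> w; apply: torso_meet t1 t2 e1H e2H R12.
apply: Or32; exists #|` gE (Defs.merge H1 H2 e1 e2)|; split=> //; last exact: ltnW.
have e1j := joins_ends ends e1; have [pH qH pq] := wf_joins (torso_wf t1) e1H e1j.
have sub2 (K : graph T E) : (ends e1).1 \in gV K -> (ends e1).2 \in gV K -> #|` gV K| = 2 ->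
    gV K = [fset (ends e1).1; (ends e1).2].
  move=> pK qK vK; apply/esym/eqP; rewrite eqEfcard cardfs2 pq vK leqnn andbT.
  by apply/fsubsetP => w; rewrite !inE => /orP[]/eqP->.
have pK : (ends e1).1 \in gV H2 by apply: (torso_incident t2 e2H); rewrite -i12 (joins_incidentl e1j).
have qK : (ends e1).2 \in gV H2 by apply: (torso_incident t2 e2H); rewrite -i12 (joins_incidentr e1j).
rewrite {1}/gV /= -!/(gV _) (sub2 H1) // (sub2 H2) // fsetUid.
by rewrite cardfs2 pq.
Qed.

Lemma tricomps_decomposition (I : seq (graph T E)) : tricomps ends (VG, EG) I ->
  exists2 R, decomposition R I & {in I, forall H, classified H}.
Proof.
case=> S [splits nsep merges _].
have [R dS] : exists R, decomposition R S.
  have [R0 d0] : exists R, decomposition R [:: (VG, EG)].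
    by exists (fun x g => g == x); apply: decomposition_host.
  elim: {S nsep merges} splits R0 d0 => [S S' st|S|S S1 S2 _ IH1 _ IH2] R0 d0.
  - exact: split_decomposition d0 st.
  - by exists R0.
  by have [R1 d1] := IH1 R0 d0; apply: IH2 d1.
exists R.
  elim: {splits nsep} merges dS => [S0 S' st dS|//|S0 S1 S2 _ IH1 _ IH2 /IH1/IH2//].
  by have [] := merge_decomposition dS st.
have cS : {in S, forall H, classified H} by move=> H /nsep h; apply: Or33.
suff [] : decomposition R I /\ {in I, forall H, classified H} by [].
elim: {splits nsep} merges dS cS => [S0 S' st dS cS|//|S0 S1 S2 _ IH1 _ IH2 dS cS].
  split; last exact: merge_classified dS st cS.
  by have [] := merge_decomposition dS st.
by have [d1 c1] := IH1 dS cS; apply: IH2.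
Qed.

End Decompositions.

(** * Criticality in terms of vertex-2-edge-separators *)

Section VertexTwoEdgeSeparators.
Variables (T E : choiceType) (ends : lab E -> T * T).
Implicit Types (e f g x y : lab E) (a b c p q u v w z : T) (H : graph T E).

Lemma wf_dele H e : wf_graph ends H -> wf_graph ends (dele H e).
Proof. by move=> wfH x; rewrite /gE /= in_fsetD1 => /andP[_ /wfH]. Qed.

Lemma dele_gE H e x : (x \in gE (dele H e)) = (x != e) && (x \in gE H).
Proof. by rewrite /gE /= in_fsetD1. Qed.

Lemma cut_dele H e c : wf_graph ends H ->
  ~ connected ends (delv ends (dele H e) c) <->
  cut ends (gV H) [pred x in gE H | x != e] c.
Proof.
move=> wfH; rewrite not_connected_cut; last exact: wf_dele.
by split; apply: sub_cut => x; rewrite /= dele_gE andbC.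
Qed.

Lemma v2e_sepP H c e1 e2 : wf_graph ends H ->
  v2e_sep ends H c e1 e2 <->
  [/\ c \in gV H, e1 \in gE H, e2 \in gE H & cut ends (gV H) (minus2 (gE H) e1 e2) c].
Proof.
move=> wfH; have eqcut : ~ connected ends (delv ends (dele (dele H e1) e2) c) <->
    cut ends (gV H) (minus2 (gE H) e1 e2) c.
  rewrite cut_dele; last exact: wf_dele.
  have eqA x : [pred x in gE (dele H e1) | x != e2] x = minus2 (gE H) e1 e2 x.
    by rewrite /minus2 /= dele_gE (andbC (x != e1)) andbA.
  by split; apply: sub_cut => x; rewrite eqA.
by split; case=> ? ? ? /eqcut.
Qed.

Lemma cut_card_gt2 V (A : pred (lab E)) c : c \in V -> cut ends V A c -> 2 < #|` V|.
Proof.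
move=> cV [X [a [b [[aV bV ac bc] Xa Xb _]]]].
have ab : a != b by apply: contraNneq Xb => <-.
have: [fset a; b; c] `<=` V.
  by apply/fsubsetP => z; rewrite !inE => /orP[/orP[]|] /eqP->.
by move/fsubset_leq_card; rewrite fsetUC cardfsU1 cardfs2 ab !inE negb_or eq_sym ac eq_sym bc.
Qed.

(** [f] may equal [e]: this is the witness used for a triangle. In other graphs 2.5-connectivity
    forces them to differ. *)
Definition all_edges_separating H : Prop := forall e, e \in gE H ->
  exists c f, [/\ c \in gV H, f \in gE H & cut ends (gV H) (minus2 (gE H) e f) c].

Lemma star_cut H (A : pred (lab E)) a b c :
  a \in gV H -> b \in gV H -> a != c -> b != c -> a != b ->
  (forall x, A x -> incident ends x c) -> cut ends (gV H) A c.
Proof.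
move=> aH bH ac bc ab inc; exists (pred1 a), a, b; split=> //=; first by rewrite eq_sym.
move=> x p q /inc xc xpq pc qc.
by case: (joins_incident xpq xc) => eqc; rewrite eqc eqxx in pc qc.
Qed.

(** [H - e] might be 2.5-connected merely as the exempt triangle. Then [H] is a triangle with a
    doubled edge: for an end [c] of [e], all edges but the one opposite [c] are incident with
    [c]. *)
Lemma triangle_plus_edge_cut H e : wf_graph ends H -> e \in gE H ->
  is_triangle ends (dele H e) ->
  exists c g, [/\ c \in gV H, g \in gE H & cut ends (gV H) [pred x in gE H | x != g] c].
Proof.
move=> wfH eH [[x0 [s [[_ ws uf us _] ls _ eS vS]]] card3].
have sz : size s = 3.
  rewrite -card3 -(size_map fst); apply/esym/perm_size; apply: uniq_perm => //.
  by move=> x; apply/idP/idP => /eS.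
case: s sz ws uf us ls eS vS => [|[e1 x1] [|[e2 x2] [|[e3 x3] []]]] //= _.
case=> e1H e1j [e2H e2j [e3H e3j _]] _ us ls eS vS; subst x3.
move: us; rewrite !inE !negb_or !andbT => /andP[/andP[x12 x10] x20].
have inE3 x : x \in gE H -> [|| x == e, x == e1, x == e2 | x == e3].
  by move=> xH; have [//|xe] := eqVneq x e; have := (eS x).1; rewrite dele_gE xe xH !inE; apply.
have [v0 v1 v2] : [/\ x0 \in gV H, x1 \in gV H & x2 \in gV H].
  by split; apply/vS; rewrite !inE eqxx ?orbT.
move: e1H e2H e3H; rewrite !dele_gE => /andP[_ e1H] /andP[_ e2H] /andP[_ e3H].
have eW := joins_incidentl (joins_ends ends e).
have : (ends e).1 \in gV H by case: (wfH e eH).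
move/(vS (ends e).1).1; rewrite !inE => /or3P[]/eqP eqw; rewrite eqw in eW.
- exists x1, e3; split=> //; apply: (@star_cut _ _ x2 x0); rewrite // 1?eq_sym // => x.
  case/andP=> /inE3/or4P[]/eqP-> //; rewrite ?eqxx // => _; first exact: joins_incidentr e1j.
  exact: joins_incidentl e2j.
- exists x2, e1; split=> //; apply: (@star_cut _ _ x1 x0); rewrite // 1?eq_sym // => x.
  case/andP=> /inE3/or4P[]/eqP-> //; rewrite ?eqxx // => _; first exact: joins_incidentr e2j.
  exact: joins_incidentl e3j.
exists x0, e2; split=> //; apply: (@star_cut _ _ x1 x2) => // x.
case/andP=> /inE3/or4P[]/eqP-> //; rewrite ?eqxx // => _; first exact: joins_incidentl e1j.
exact: joins_incidentr e3j.
Qed.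

(** Connectedness is the delicate point. If [H - e] fell apart, another edge [x] would have both
    ends in one part, and deleting its end [p] would leave vertices in both. If [e] were the only
    edge, [H] could be a single link, whose two isolated vertices admit no such cut. *)
Lemma dele_biconnected H e : wf_graph ends H -> e \in gE H -> #|` gE H| != 1 ->
  (forall c, c \in gV H -> ~ cut ends (gV H) [pred x in gE H | x != e] c) ->
  biconnected ends (dele H e).
Proof.
move=> wfH eH card1 ncut; split.
  move=> a b aH bH; apply: NNPP => nab.
  have E2 : 2 <= #|` gE H|.
    by move: card1 (cardfs_gt0 (gE H)); case: #|` _| => [|[]] // _ /esym/fset0Pn[]; exists e.
  have [x [xH xe]] := fset_ge2_other e E2; have xj := joins_ends ends x.
  have [pH qH pq] := wf_joins wfH xH xj; move: (ends x).1 (ends x).2 xj pH qH pq => p q xj pH qH pq.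
  pose X z := asb (reach ends (dele H e) a z).
  have cl g r s : g \in gE H -> g != e -> joins ends g r s -> X r -> X s.
    move=> gH ge grs /asbP ar; apply/asbP; apply: (reachS ar).
    by have [rH sH _] := wf_joins wfH gH grs; split=> //; exists g; rewrite dele_gE ge.
  have Xa : X a by apply/asbP/reach0.
  have Xb : ~~ X b by apply/asbP.
  have clp g r s : [pred x in gE H | x != e] g -> joins ends g r s -> r != p -> s != p -> X r -> X s.
    by move=> /andP[gH ge] grs _ _; apply: cl grs.
  have qp : q != p by rewrite eq_sym.
  have [Xp|nXp] := boolP (X p).
    apply: (ncut p pH); exists X, q, b; split=> //; last exact: cl xj Xp.
    by split=> //; apply: contraNneq Xb => ->.
  apply: (ncut p pH); exists X, a, q; split=> //.
    by split=> //; apply: contraNneq nXp => <-.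
  by apply: contra nXp; apply: (cl x); rewrite // joinsC.
move=> a b c aH bH cH ab ac bc; apply: NNPP => nab; apply: (ncut c cH).
by apply/cut_dele => // con; apply: nab; apply: con; rewrite !inE /= ?ac ?bc.
Qed.

(** A pair [(c, f)] violating 2.5-connectivity of [H - e] is a separator [(c, e, f)] of [H]. For a
    triangle both sides of the equivalence hold outright. *)
Lemma critical_all_edges_separating H : wf_graph ends H -> #|` gE H| != 1 ->
  twofive ends H -> critical ends H <-> all_edges_separating H.
Proof.
move=> wfH card1 tw; have [_ [[cH _]|noC]] := tw.
  split=> [_ e eH|_].
    have [c cV hc] := cycle_cut cH eH; exists c, e; split=> //.
    by apply: sub_cut hc => x /and3P[] /= -> ->.
  split=> // e eH [bic _]; have [c cV hc] := cycle_cut cH eH.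
  apply: (biconnected_no_cut bic cV); apply: sub_cut hc => x /=.
  by rewrite dele_gE andbC.
have twoH c e : c \in gV H -> e \in gE H -> ~ cut ends (gV H) [pred x in gE H | x != e] c.
  by move=> cH eH /cut_dele h; apply: noC; exists c, e; split=> //; apply: h.
split=> [[_ crit] e eH|sep].
  apply: NNPP => none; apply: (crit e eH); split.
    by apply: dele_biconnected => // c cH; apply: twoH.
  right=> -[c [f [cH]]]; rewrite dele_gE => /andP[fe fH] dis; apply: none; exists c, f.
  by have /v2e_sepP[] : v2e_sep ends H c e f by split.
split=> // e eH [bic tri]; have [c [f [cH fH hc]]] := sep e eH.
have fe : f != e.
  apply/eqP => fe; apply: (twoH c e cH eH); apply: sub_cut hc => x.
  by rewrite fe /minus2 => /andP[/= -> ->].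
case: tri => [tri|]; last first.
  case; exists c, f; split=> //; first by rewrite dele_gE fe.
  by have [] : v2e_sep ends H c e f by apply/v2e_sepP.
have [c' [g [c'H gH]]] := triangle_plus_edge_cut wfH eH tri.
exact: twoH.
Qed.

End VertexTwoEdgeSeparators.

(** * Separators of the host graph against the conditions on components *)

Section Characterisation.
Variables (T E : choiceType) (ends : lab E -> T * T).
Variables (VG : {fset T}) (EG : {fset lab E}).
Hypothesis wfG : wf_graph ends (VG, EG).
Hypothesis bicG : forall c, c \in VG -> ~ cut ends VG (mem EG) c.
Hypothesis degG : min_deg2 ends (VG, EG).
Hypothesis nonvirtualG : forall g, g \in EG -> nonvirtual g.
Variables (R : lab E -> pred (lab E)) (I : seq (graph T E)).
Hypothesis decI : decomposition ends VG EG R I.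
Hypothesis clsI : {in I, forall H, classified ends H}.
Implicit Types (e f g x y : lab E) (c u v w : T) (b : bool) (H : graph T E).

Local Notation touches := (touches ends EG).
Local Notation virt := (virt E).

Lemma touchG w : w \in VG -> touches predT w.
Proof.
by move=> /degG-/(_ (virt 0 true))[y [yE _ yw]]; apply/touchesP; exists y.
Qed.

Lemma label_cases x : nonvirtual x \/ exists k b, x = virt k b.
Proof. by case: x => [e|[k b]]; [left; exists e | right; exists k, b]. Qed.

Lemma nonvirtual_stands x g : nonvirtual x -> R x g = (g == x).
Proof. by case=> e ->; apply: (dec_nonvirtual decI). Qed.

Lemma nonvirtual_host H x : H \in I -> x \in gE H -> nonvirtual x -> x \in EG.
Proof.
move=> HI xH nx; have [h _ _] := torso_stands (dec_torso decI HI) xH; apply: h.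
by rewrite nonvirtual_stands.
Qed.

Lemma nonvirtual_touches x w : nonvirtual x -> touches (R x) w -> incident ends x w.
Proof. by move=> nx /touchesP[g [_]]; rewrite nonvirtual_stands // => /eqP->. Qed.

Lemma lift_edges_pair H e f g : H \in I -> e \in gE H -> f \in gE H ->
  nonvirtual e -> nonvirtual f ->
  lift_edges R H [pred x | (x == e) || (x == f)] g = (g == e) || (g == f).
Proof.
move=> HI eH fH ne nf; apply/hasP/orP => [[x _ /andP[/orP[]/eqP->]]|[]/eqP->].
- by rewrite nonvirtual_stands //; left.
- by rewrite nonvirtual_stands //; right.
- by exists e; rewrite //= nonvirtual_stands // !eqxx.
by exists f; rewrite //= nonvirtual_stands // !eqxx orbT.
Qed.

Lemma cut_component H c e f : H \in I -> c \in gV H -> e \in gE H -> f \in gE H ->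
  nonvirtual e -> nonvirtual f ->
  cut ends (gV H) (minus2 (gE H) e f) c <-> cut ends VG (minus2 EG e f) c.
Proof.
move=> HI cH eH fH ne nf; have tH := dec_torso decI HI.
have inD x w : x \in gE H -> [pred x | (x == e) || (x == f)] x ->
    touches (R x) w -> w \in gV H.
  move=> xH /= /orP[]/eqP ex xw; apply: (torso_incident tH xH);
    by apply: nonvirtual_touches; rewrite ?ex // -ex.
split=> hc.
  apply: sub_cut (cut_torso_host tH cH inD _) => [g|]; last apply: sub_cut hc => x.
    by rewrite /minus2 /= lift_edges_pair // negb_or.
  by rewrite /minus2 /= negb_or.
apply: sub_cut (cut_host_torso wfG bicG touchG tH cH inD _) => [x|]; last apply: sub_cut hc => g.
  by rewrite /minus2 /= negb_or.
by rewrite /minus2 /= lift_edges_pair // negb_or.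
Qed.

Lemma index_uniq i j x : i < size I -> j < size I ->
  x \in gE (Defs.comp I i) -> x \in gE (Defs.comp I j) -> i = j.
Proof.
wlog ij : i j / i < j => [hwlog iI jI xi xj|iI jI].
  have [ij|ji|//] := ltngtP i j; first exact: hwlog xi xj.
  by apply/esym; apply: hwlog xj xi.
rewrite /Defs.comp => xi xj; have := dec_uniq decI x.
rewrite /occurrences -(cat_take_drop j I) count_cat (drop_nth (fset0, fset0)) //= xj.
suff : 0 < count (fun H => x \in gE H) (take j I).
  by case: (count _ (take j I)) => // n _; rewrite add1n addnS.
rewrite -has_count; apply/hasP; exists (nth (fset0, fset0) I i) => //.
by rewrite -(nth_take _ ij); apply: mem_nth; rewrite size_takel // ltnW.
Qed.

Lemma occurs_index x : 0 < occurrences I x ->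
  exists2 i, i < size I & x \in gE (Defs.comp I i).
Proof.
by rewrite -has_count => /hasP[H /(nthP (fset0, fset0))[i iI <-] xH]; exists i.
Qed.

(** For a 3-edge [y], [e], [f] the partner [y2] of [y] stands for [e] and [f] alone. In the
    neighbouring cycle [y2] and a vertex separate, and lifting this cut gives a separator with [e]
    and [f]. *)
Lemma separators_of_conditions : condA ends I -> condB ends I ->
  all_edges_separating ends (VG, EG).
Proof.
move=> cA cB e eE; have [i iI eH] := occurs_index (dec_cover decI eE).
set H := Defs.comp I i in eH; have HI : H \in I by apply: mem_nth.
have tH := dec_torso decI HI.
have ne := nonvirtualG eE.
have [kH|nkH] := classic (kedge_nonvirt H); last first.
  have [c [e1 [e2 [/(v2e_sepP _ _ _ (torso_wf tH))[cH e1H e2H hc] ee n1 n2]]]] := cB i iI nkH e eH ne.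
  have := hc; rewrite cut_component // => hG.
  case: ee => ee; [exists c, e2 | exists c, e1]; rewrite ee; split;
    rewrite ?(torso_sub tH) ?(nonvirtual_host HI) //.
  by apply: sub_cut hG => g; rewrite minus2C.
have [[V2 E3 _] [y [yH _ yuniq]] [j [jI [_ [y1 [y2 [y1H y2H cor]]]] _ cyc]]] := cA i iI kH.
rewrite -/H in V2 E3 yH yuniq y1H.
set H' := Defs.comp I j in y2H cyc; have H'I : H' \in I by apply: mem_nth.
have t' := dec_torso decI H'I.
have [k [b [ey1 ey2]]] := cor.
have yy1 : y1 = y by apply: yuniq => //; exists k, b.
rewrite yy1 in ey1; have [ck _] : complementary ends EG R k /\ 2 < #|` gE H|.
  by apply: (dec_compl decI (b := b) HI); rewrite -ey1.
have R12 : {in EG, forall g, R y g = ~~ R y2 g}.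
  by rewrite ey1 ey2; apply: complementary_corr ck.
have i12 w : incident ends y w = incident ends y2 w.
  by rewrite ey1 ey2; apply: complementary_incident ck.
have Ry2 g : R y2 g -> g \in gE H /\ g != y.
  move=> Rg; have gE : g \in EG by have [h _ _] := torso_stands t' y2H; apply: h.
  have nRg : ~~ R y g by rewrite R12 // Rg.
  have [x [xH Rx]] := torso_cover tH gE.
  have xy : x != y by apply: contraNneq nRg => <-.
  have nx : nonvirtual x.
    by case: (label_cases x) => // vx; rewrite (yuniq x xH vx) eqxx in xy.
  by move: Rx; rewrite nonvirtual_stands // => /eqP->.
have ey : e != y by rewrite ey1; case: ne => e' ->.
have [f [fH fe fy]] : exists f, [/\ f \in gE H, f != e & f != y] by apply: fset_ge3_other; rewrite E3.
have EH : gE H = [fset y; e; f].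
  apply/esym/eqP; rewrite eqEfcard; apply/andP; split.
    by apply/fsubsetP => x; rewrite !inE => /orP[/orP[]|]/eqP->.
  by rewrite E3 fsetUC cardfsU1 cardfs2 !inE negb_or fy fe eq_sym ey.
have nf : nonvirtual f.
  by case: (label_cases f) => // vx; rewrite (yuniq f fH vx) eqxx in fy.
have VH w : w \in gV H -> incident ends y w.
  have yj := joins_ends ends y; have [pH qH pq] := wf_joins (torso_wf tH) yH yj.
  have -> : gV H = [fset (ends y).1; (ends y).2].
    apply/esym/eqP; rewrite eqEfcard cardfs2 pq V2 leqnn andbT.
    by apply/fsubsetP => z; rewrite !inE => /orP[]/eqP->.
  by rewrite !inE => /orP[]/eqP->; rewrite ?(joins_incidentl yj) ?(joins_incidentr yj).
have [c cH' hc] := cycle_cut cyc y2H.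
exists c, f; split; [exact: torso_sub t' _ cH' | exact: nonvirtual_host HI fH nf |].
apply: sub_cut (cut_torso_host (D := pred1 y2) t' cH' _ _) => //.
  move=> g; rewrite /minus2 => /and3P[gE ge gf] /=; rewrite gE /=.
  apply/hasPn => x _; apply/negP => /andP[/eqP-> /Ry2[]].
  by rewrite EH !inE (negPf ge) (negPf gf) !orbF => ->.
(* The ends of [e] and [f] are the two vertices of the 3-edge, that is, the ends of [y] and of
   [y2]. *)
move=> x w _ /eqP-> /touchesP[g [_ /Ry2[gH _] gw]].
by apply: (torso_incident t' y2H); rewrite -i12; apply: VH; apply: torso_incident tH gH gw.
Qed.

Hypothesis twoG : forall c e, c \in VG -> e \in EG ->
  ~ cut ends VG [pred g in EG | g != e] c.

Lemma separator_same_component H c e f : H \in I -> e \in gE H -> nonvirtual e ->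
  c \in VG -> f \in EG -> cut ends VG (minus2 EG e f) c ->
  f \in gE H /\ nonvirtual f.
Proof.
move=> HI eH ne cV fE hc; have tH := dec_torso decI HI.
have eE := nonvirtual_host HI eH ne.
have [x [xH Rf]] := torso_cover tH fE.
case: (label_cases x) => [nx|[k [b xk]]].
  by move: Rf; rewrite nonvirtual_stands // => /eqP->.
have xe : x != e by rewrite xk; case: ne => e' ->.
have [[_ _ two] card] : complementary ends EG R k /\ 2 < #|` gE H|.
  by apply: (dec_compl decI (b := b) HI); rewrite -xk.
have outside y g : y \in gE H -> y != x -> R y g -> g \in EG /\ ~~ R x g.
  move=> yH yx Ry; have [h _ _] := torso_stands tH yH; split; first exact: h.
  by apply: contra yx => Rx; rewrite (torso_inj tH yH xH Ry Rx).
(* The second edges on the two sides of [R x]: [f'] from the bound on [R x], and [e'] from a third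
   edge [y] of [H]. *)
have [f' [f'E Rf' f'f]] : exists f', [/\ f' \in EG, R x f' & f' != f].
  have [h _ _] := torso_stands tH xH.
  have [g1 [g2 []]] := two b; rewrite -xk => R1 R2 g12.
  have [g1f|g1f] := eqVneq g1 f; last by exists g1; split=> //; apply: h.
  by exists g2; split; [apply: h | | rewrite -g1f eq_sym].
have [y [yH yx ye]] := fset_ge3_other x e card.
have [e' Re'] := torso_nonempty tH yH; have [e'E nRe'] := outside y e' yH yx Re'.
have Ree : R e e by rewrite nonvirtual_stands.
have [_ nRe] : e \in EG /\ ~~ R x e by apply: (outside e); rewrite // eq_sym.
have e'e : e' != e.
  by apply: contra ye => /eqP ee; rewrite ee in Re'; rewrite (torso_inj tH yH eH Re' Ree).
case: (no_cut_across wfG twoG (torso_sep2 tH xH (joins_ends ends x)) cV eE fE nRe Rf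
  e'E nRe' e'e f'E Rf' f'f hc).
Qed.

Lemma separator_component H c e f : H \in I -> e \in gE H -> nonvirtual e ->
  c \in VG -> f \in EG -> cut ends VG (minus2 EG e f) c ->
  (exists2 c', c' \in gV H & cut ends (gV H) (minus2 (gE H) e f) c') \/
  exists k b, [/\ virt k b \in gE H, c \notin gV H, kedge 3 H,
    gE H = [fset virt k b; e; f] &
    (forall g, g \in EG -> ~~ R (virt k b) g -> (g == e) || (g == f)) /\
    (forall w, w \in gV H -> incident ends (virt k b) w)].
Proof.
move=> HI eH ne cV fE hc; have tH := dec_torso decI HI.
have [fH nf] := separator_same_component HI eH ne cV fE hc.
have [cH|cH] := boolP (c \in gV H); first by left; exists c => //; apply/cut_component.
have [y [yH yc]] := torso_touch touchG tH cV.
case: (label_cases y) => [ny|[k [b yk]]].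
  by case/negP: cH; apply: (torso_incident tH yH); apply: nonvirtual_touches.
have yj := joins_ends ends y; move: (ends y).1 (ends y).2 yj => u v yj.
have [uH vH uv] := wf_joins (torso_wf tH) yH yj.
have [ye yf] : y != e /\ y != f by rewrite yk; case: ne => ? ->; case: nf => ? ->.
have [Ree Rff] : R e e /\ R f f by rewrite !nonvirtual_stands.
have out x g : x \in gE H -> y != x -> R x g -> ~~ R y g.
  by move=> xH yx Rx; apply: contra yx => Ry; rewrite (torso_inj tH yH xH Ry Rx).
have nc w : w \in gV H -> w != c by apply: contraTneq => ->.
have := cut_inner wfG bicG (torso_sep2 tH yH yj) cV (torso_inner tH yH cH yc) (nc u uH)
  (nc v vH) (out e e eH ye Ree) (out f f fH yf Rff) hc.
case=> [hu|hv|[eF vF]].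
- by left; exists u => //; apply/cut_component.
- by left; exists v => //; apply/cut_component.
right; exists k, b; rewrite -yk.
have ef : e != f.
  apply/eqP => ef; apply: (twoG cV fE); apply: sub_cut hc => g.
  by rewrite ef /minus2 => /andP[/= -> ->].
have EH : gE H = [fset y; e; f].
  apply/fsetP => x; rewrite !inE -orbA; apply/idP/or3P => [xH|[]/eqP-> //].
  have [|yx] := eqVneq x y; first by constructor 1.
  have [g Rg] := torso_nonempty tH xH.
  have gE : g \in EG by have [h _ _] := torso_stands tH xH; apply: h.
  have nRg : ~~ R y g by apply: (out x) => //; rewrite eq_sym.
  case/orP: (eF g gE nRg) => /eqP eg; rewrite eg in Rg.
    by rewrite (torso_inj tH xH eH Rg Ree) eqxx; constructor 2.
  by rewrite (torso_inj tH xH fH Rg Rff) eqxx; constructor 3.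
(* An edge other than [y] at [w] shows that [w] is touched from outside [R y], where only [u] and
   [v] are. *)
have Vuv w : w \in gV H -> w = u \/ w = v.
  move=> wH; have [x [xH xy xw]] := torso_deg tH y wH; apply: vF.
  apply: (torso_touchC tH yH xH); first by rewrite eq_sym.
  by have [_ h _] := torso_stands tH xH; apply: h.
have VH : gV H = [fset u; v].
  apply/fsetP => w; rewrite !inE; apply/idP/orP => [/Vuv[]->|[]/eqP-> //]; rewrite eqxx; auto.
split=> //.
  by split=> //; [rewrite VH cardfs2 uv | rewrite EH fsetUC cardfsU1 cardfs2 !inE negb_or
     ye eq_sym yf eq_sym ef].
by split=> // w /Vuv[]->; rewrite ?(joins_incidentl yj) ?(joins_incidentr yj).
Qed.

Lemma conditions_of_separators : all_edges_separating ends (VG, EG) ->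
  condA ends I /\ condB ends I.
Proof.
move=> sep; split=> i iI; set H := Defs.comp I i.
all: have HI : H \in I by apply: mem_nth.
all: have tH := dec_torso decI HI.
  case=> -[k0 [V2 _ _]] [e [eH ne]].
  have eE := nonvirtual_host HI eH ne; have [c [f [cV fE hc]]] := sep e eE.
  have [fH nf] := separator_same_component HI eH ne cV fE hc.
  (* A cut needs three vertices, so a k-edge falls under the second alternative. *)
  case: (separator_component HI eH ne cV fE hc) => [[c' c'H hc']|].
    by have := cut_card_gt2 c'H hc'; rewrite V2.
  case=> k [b [yH cH k3 EH [outer VH]]]; set y := virt k b in yH EH outer VH.
  have yuniq x : x \in gE H -> virtual x -> x = y.
    rewrite EH !inE -orbA => /or3P[]/eqP-> // [k' [b' ek]].
      by case: ne => ? en; rewrite en in ek.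
    by case: nf => ? en; rewrite en in ek.
  split=> //; first by exists y; split=> //; exists k, b.
  have := occurs_index (x := virt k (~~ b)); rewrite -(dec_pair decI) => -[|j jI y'H'].
    by rewrite -has_count; apply/hasP; exists H.
  set y' := virt k (~~ b) in y'H'; set H' := Defs.comp I j in y'H'.
  have H'I : H' \in I by apply: mem_nth.
  have t' := dec_torso decI H'I.
  have [ck card'] : complementary ends EG R k /\ 2 < #|` gE H'|.
    exact: (dec_compl decI H'I y'H').
  exists j; split=> //.
  - split; last by exists y, y'; split=> //; exists k, b.
    apply/eqP => ij; move: y'H'; rewrite /H' -ij -/H => /yuniq yy.
    have : y' = y by apply: yy; exists k, (~~ b).
    by rewrite /y' /y; case; case: (b).
  - move=> j' j'I [_ [x1 [x2 [x1H x2H [k' [b' [ex1 ex2]]]]]]].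
    have : x1 = y by apply: yuniq => //; exists k', b'.
    rewrite ex1 => -[ek eb]; rewrite ex2 ek eb in x2H.
    exact: index_uniq x2H y'H'.
  have R12 g : g \in EG -> R y' g = ~~ R y g.
    by move=> gE; rewrite /y (complementary_corr b ck) // negbK.
  have i12 w : incident ends y' w = incident ends y w.
    by rewrite /y (complementary_incident b w ck).
  have Ree : R e e by rewrite nonvirtual_stands.
  have Rff : R f f by rewrite nonvirtual_stands.
  have [ye yf] : y != e /\ y != f by rewrite /y; case: ne => ? ->; case: nf => ? ->.
  have R'e : R y' e.
    by rewrite R12 //; apply: contra ye => Ry; rewrite (torso_inj tH yH eH Ry Ree).
  have R'f : R y' f.
    by rewrite R12 //; apply: contra yf => Ry; rewrite (torso_inj tH yH fH Ry Rff).
  have R'ef g : R y' g -> (g == e) || (g == f).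
    move=> Rg; have gE : g \in EG by have [h _ _] := torso_stands t' y'H'; apply: h.
    by apply: outer => //; rewrite -R12.
  have R'V w : touches (R y') w -> w \in gV H.
    case/touchesP=> g [_ /R'ef/orP[]/eqP-> gw]; first exact: torso_incident tH eH gw.
    exact: torso_incident tH fH gw.
  (* The vertex [c] is moved into [H']. If it is strictly inside some [R z] and no end of [z]
     serves, every edge outside [R z] is [e] or [f], hence in [R y'], and [H'] has no third edge. *)
  have [c' c'H' hc'] : exists2 c', c' \in gV H' & cut ends VG (minus2 EG e f) c'.
    have [cH'|cH'] := boolP (c \in gV H'); first by exists c.
    have [z [zH' zc]] := torso_touch touchG t' cV.
    have zy : z != y' by apply: contraNneq cH => zy; rewrite zy in zc; apply: R'V.
    have zj := joins_ends ends z; move: (ends z).1 (ends z).2 zj => u v zj.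
    have [uH' vH' uv] := wf_joins (torso_wf t') zH' zj.
    have nR g : R y' g -> ~~ R z g.
      by move=> Ry; apply: contra zy => Rz; rewrite (torso_inj t' zH' y'H' Rz Ry).
    have nc w : w \in gV H' -> w != c by apply: contraTneq => ->.
    have := cut_inner wfG bicG (torso_sep2 t' zH' zj) cV (torso_inner t' zH' cH' zc)
      (nc u uH') (nc v vH') (nR e R'e) (nR f R'f) hc.
    case=> [hu|hv|[only _]]; [by exists u | by exists v |].
    have [x [xH' xz xy]] := fset_ge3_other z y' card'.
    have [g Rg] := torso_nonempty t' xH'.
    have gE : g \in EG by have [h _ _] := torso_stands t' xH'; apply: h.
    have nRz : ~~ R z g by apply: contra xz => Rz; rewrite (torso_inj t' xH' zH' Rg Rz).
    have R'g : R y' g by case/orP: (only g gE nRz) => /eqP->.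
    by rewrite (torso_inj t' xH' y'H' Rg R'g) eqxx in xy.
  (* [e] and [f] make up [R y'], so deleting them amounts to deleting the one edge [y'] of [H']. *)
  have hH' : cut ends (gV H') [pred x in gE H' | x != y'] c'.
    apply: (cut_host_torso (D := pred1 y') wfG bicG touchG t' c'H').
      move=> x w _ /eqP-> /R'V/VH; rewrite -i12; exact: torso_incident t' y'H'.
    apply: sub_cut hc' => g /andP[/= gE nl]; rewrite /minus2 [_ \in _]gE /=.
    have lifted h : R y' h -> lift_edges R H' (pred1 y') h.
      by move=> Rh; rewrite (lift_edgesE _ t' y'H' Rh) /=.
    by apply/andP; split; apply: contraNneq nl => ->; apply: lifted.
  case: (clsI H'I) => [//|[k' [V2' _ _]]|nsep].
    by have := cut_card_gt2 c'H' hH'; rewrite V2'.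
  apply: (cut_no_sep_pair_cycle (torso_wf t') _ nsep c'H' y'H' _ hH').
    exact: torso_deg t'.
  exact: torso_no_cut t' c'H'.
move=> nk e eH ne; have eE := nonvirtual_host HI eH ne; have [c [f [cV fE hc]]] := sep e eE.
have [fH nf] := separator_same_component HI eH ne cV fE hc.
case: (separator_component HI eH ne cV fE hc) => [[c' c'H hc']|].
  by exists c', e, f; split; auto; apply/v2e_sepP => //; apply: torso_wf tH.
by case=> k [b [_ _ k3 _ _]]; case: nk; split; [exists 3 | exists e].
Qed.

End Characterisation.

(** * Graphs with few edges, and the theorem *)

Lemma tricomps_few_edges (T E : choiceType) (ends : lab E -> T * T)
    (G : graph T E) (I : seq (graph T E)) :
  #|` gE G| < 4 -> tricomps ends G I -> I = [:: G].
Proof.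
move=> lt4 [S [splits _ merges _]].
have fixed (step : seq (graph T E) -> seq (graph T E) -> Prop) S1 S2 :
    (forall S', ~ step [:: G] S') -> clos_refl_trans _ step S1 S2 ->
    S1 = [:: G] -> S2 = [:: G].
  move=> nstep; elim=> [S1' S2' st eqS|//|S1' S2' S3' _ IH1 _ IH2 /IH1/IH2 //].
  by rewrite eqS in st; case: (nstep S2').
apply: (fixed _ S I _ merges); last apply: (fixed _ _ S _ splits) => //.
  move=> S' [S1 [S2 [S3 [H1 [H2 [e1 [e2 [[eqI _ _ _ _] _]]]]]]]].
  by move: (congr1 size eqI); rewrite !size_cat /= size_cat /= !addnS.
(* A split has two edges on either side, so it needs at least four. *)
move=> S' [S1 [S2 [H [u [v [E' [k [[eqH [[_ _ _ sE' _] [E'2 D2]] _ _ _] _]]]]]]]].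
have eqHG : H = G by move: eqH; case: S1 => [[->]|? []].
move: lt4; rewrite -eqHG ltnNge -(cardfsID E') (fsetIidPr sE').
by rewrite (leq_add E'2 D2).
Qed.

(** When the only component is no k-edge, condition (a) is vacuous, and without virtual edges
    condition (b) is the separator property itself. *)
Lemma conditions_single (T E : choiceType) (ends : lab E -> T * T) (G : graph T E) :
  wf_graph ends G -> (forall g, g \in gE G -> nonvirtual g) ->
  (forall k, ~ kedge k G) ->
  condA ends [:: G] /\ condB ends [:: G] <-> all_edges_separating ends G.
Proof.
move=> wfG nvG nk; have nkv : ~ kedge_nonvirt G by case=> -[k /nk].
split=> [[_ cB] e eG|sep].
  have [c [e1 [e2 [/(v2e_sepP _ _ _ wfG)[cG e1G e2G hc] ee _ _]]]] := cB 0 isT nkv e eG (nvG e eG).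
  case: ee => ->; [by exists c, e2 | exists c, e1; split=> //].
  by apply: sub_cut hc => x; rewrite minus2C.
split=> -[//|] //= _ _ e eG ne; have [c [f [cG fG hc]]] := sep e eG.
by exists c, e, f; split; auto; apply/v2e_sepP.
Qed.

Theorem theorem6 (T E : choiceType) (ends : lab E -> T * T)
  (VG : {fset T}) (EG : {fset E}) (I : seq (graph T E)) :
  wf_graph ends (Gof VG EG) ->
  #|` EG| != 1 ->
  twofive ends (Gof VG EG) ->
  tricomps ends (Gof VG EG) I ->
  (critical ends (Gof VG EG) <-> condA ends I /\ condB ends I).
Proof.
move=> wfG card1 tw tri; set G := Gof VG EG in wfG tw tri *.
have cardG : #|` gE G| = #|` EG| by rewrite card_imfset // => x y [].
have nvG g : g \in gE G -> nonvirtual g by case/imfsetP=> e _ ->; exists e.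
rewrite critical_all_edges_separating ?cardG //.
(* A triangle violates [twoG] below, so it goes through the single-component case. *)
have [bic [[cyc card3]|noC]] := tw.
  have lt4 : #|` gE G| < 4 by rewrite card3.
  rewrite (tricomps_few_edges lt4 tri) conditions_single // => k [V2 _ _].
  have [e [eG _]] := fset_ge2_other (virt E 0 true) (A := gE G) ltac:(by rewrite card3).
  by have [c cG /(cut_card_gt2 cG)] := cycle_cut cyc eG; rewrite V2.
(* The degree bound [degG] needs two edges; with fewer, nothing can be split. *)
have [E2|E2] := leqP 2 #|` gE G|; last first.
  have lt4 : #|` gE G| < 4 by apply: leq_trans E2 _.
  rewrite (tricomps_few_edges lt4 tri) conditions_single // => k [_ Ek k2].
  by rewrite Ek ltnNge k2 in E2.
have twoG c e : c \in gV G -> e \in gE G -> ~ cut ends (gV G) [pred x in gE G | x != e] c.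
  by move=> cG eG /cut_dele h; apply: noC; exists c, e; split=> //; apply: h.
have bicG c : c \in gV G -> ~ cut ends (gV G) (mem (gE G)) c.
  exact: biconnected_no_cut.
(* If no edge besides [x] met [w], deleting [x] and an end of another edge [g] would isolate [w]. *)
have degG : min_deg2 ends G.
  move=> w x wG; have [g [gG gx]] := fset_ge2_other x E2.
  have [gw|gw] := boolP (incident ends g w); first by exists g.
  apply: NNPP => none; have gj := joins_ends ends g; have [pG qG pq] := wf_joins wfG gG gj.
  have wp : w != (ends g).1 by apply: contraNneq gw => ->; apply: joins_incidentl gj.
  have wq : w != (ends g).2 by apply: contraNneq gw => ->; apply: joins_incidentr gj.
  have hc : cut ends (gV G) [pred y in gE G | y != x] (ends g).1.
    exists (pred1 w), w, (ends g).2; split=> //=.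
    - by split=> //; rewrite eq_sym.
    - by rewrite eq_sym.
    move=> y p q /andP[yG yx] ypq _ _ /eqP pw; case: none; exists y; split=> //.
    by rewrite -pw; apply: joins_incidentl ypq.
  have [xG|xG] := boolP (x \in gE G); first exact: twoG hc.
  apply: (bicG _ pG); apply: sub_cut hc => y yG; rewrite /= [_ \in _]yG.
  by apply: contraNneq xG => <-.
have [R decI clsI] := tricomps_decomposition wfG bicG degG nvG tri.
split=> [|[cA cB]]; first exact: conditions_of_separators decI clsI twoG.
exact: separators_of_conditions decI cA cB.
Qed.
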